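(* There is a particular first-order, parameter-free definable two-player proper-class game (with moves from a definable class $X$ and a definable winning class $A\subseteq X^\omega$) such that {\rm ZFC} proves that the game is clopen, and such that for every first-order formula $\psi(u,v)$ in the language of set theory, {\rm ZFC} proves: for no set parameter $p$ is the class $\{u \mid \psi(u,p)\}$ a winning strategy for either player in this game. (This is a theorem scheme over all formulas $\psi$.)
   Context: A class game is a two-player game of perfect information: players I and II alternately choose elements of a (possibly proper) class $X$, producing a play $\vec\alpha=\langle\alpha_0,\alpha_1,\dots\rangle\in X^\omega$; player I wins the play iff $\vec\alpha\in A$ for a fixed class $A\subseteq X^\omega$, otherwise player II wins. A strategy is a class function $\sigma:X^{<\omega}\to X$; it is winning for a player if every play in which that player follows $\sigma$ is won by that player. The game is open for a player if that player's winning class is open in the product topology on $X^\omega$ with $X$ discrete (every winning play has a finite initial segment all of whose extensions are winning for that player), and clopen if it is open for both players. *)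

(* Defs.v *)
From mathcomp Require Import all_boot.
From Stdlib Require List.

Set Implicit Arguments.
Unset Strict Implicit.
Unset Printing Implicit Defensive.

(** * First-order formulas of the language of set theory

    Variables are de Bruijn indices; the language has no function symbols, so
    the only terms are variables and every substitution is a renaming. *)

Inductive form : Type :=
| fBot : form
| fMem : nat -> nat -> form
| fEq : nat -> nat -> form
| fImp : form -> form -> form
| fAll : form -> form.

Definition fNot p := fImp p fBot.
Definition fAnd p q := fNot (fImp p (fNot q)).
Definition fOr p q := fImp (fNot p) q.
Definition fIff p q := fAnd (fImp p q) (fImp q p).
Definition fEx p := fNot (fAll (fNot p)).

Declare Scope form_scope.
Delimit Scope form_scope with F.
Bind Scope form_scope with form.
Notation "x ∈ y" := (fMem x y) (at level 70, no associativity) : form_scope.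
Notation "x ≡ y" := (fEq x y) (at level 70, no associativity) : form_scope.
Notation "¬ p" := (fNot p) (at level 75, right associativity) : form_scope.
Notation "p ∧ q" := (fAnd p q) (at level 80, right associativity) : form_scope.
Notation "p ∨ q" := (fOr p q) (at level 85, right associativity) : form_scope.
Notation "p → q" := (fImp p q)
  (at level 99, q at level 200, right associativity) : form_scope.
Notation "p ↔ q" := (fIff p q) (at level 95, no associativity) : form_scope.
Notation "∀ p" := (fAll p) (at level 200, p at level 200) : form_scope.
Notation "∃ p" := (fEx p) (at level 200, p at level 200) : form_scope.
Local Open Scope form_scope.

(** Lifting of a renaming under a binder. *)
Definition up (r : nat -> nat) (k : nat) : nat :=
  if k is k'.+1 then (r k').+1 else 0.

Fixpoint ren (r : nat -> nat) (p : form) : form :=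
  match p with
  | fBot => fBot
  | fMem x y => fMem (r x) (r y)
  | fEq x y => fEq (r x) (r y)
  | fImp q1 q2 => fImp (ren r q1) (ren r q2)
  | fAll q => fAll (ren (up r) q)
  end.

(** Instantiation of the variable 0 of [p] by [t]; the other variables of [p]
    are lowered by one. *)
Definition inst (t : nat) (p : form) : form :=
  ren (fun k => if k is k'.+1 then k' else t) p.

(** All free variables of [p] are among 0, ..., n - 1. *)
Fixpoint bounded (n : nat) (p : form) : bool :=
  match p with
  | fBot => true
  | fMem x y => (x < n) && (y < n)
  | fEq x y => (x < n) && (y < n)
  | fImp q1 q2 => bounded n q1 && bounded n q2
  | fAll q => bounded n.+1 q
  end.

(** [app1 P x] is P(x) for a formula P(v0); [app2 P x y] is P(x, y) for a
    formula P(v0, v1). *)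
Definition app1 (P : form) (x : nat) : form := ren (fun _ => x) P.
Definition app2 (P : form) (x y : nat) : form :=
  ren (fun k => if k is 0 then x else y) P.

(** * Provability: classical natural deduction with equality *)

Inductive nd (T : form -> Prop) : list form -> form -> Prop :=
| nd_ax G p : T p -> nd T G p
| nd_hyp G p : List.In p G -> nd T G p
| nd_impI G p q : nd T (p :: G) q -> nd T G (p → q)
| nd_impE G p q : nd T G (p → q) -> nd T G p -> nd T G q
| nd_raa G p : nd T ((¬ p) :: G) fBot -> nd T G p
| nd_allI G p : nd T (List.map (ren S) G) p -> nd T G (∀ p)
| nd_allE G p t : nd T G (∀ p) -> nd T G (inst t p)
| nd_refl G x : nd T G (x ≡ x)
| nd_subst G p x y : nd T G (x ≡ y) -> nd T G (inst x p) -> nd T G (inst y p).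

Definition provable (T : form -> Prop) (p : form) : Prop := nd T nil p.

(** * Basic set-theoretic vocabulary

    Arguments are variables; under k binders an outer variable [x] is
    referred to as [x + k]. *)

Definition fSub x y := ∀ 0 ∈ x.+1 → 0 ∈ y.+1.
Definition fEmpty x := ∀ ¬ 0 ∈ x.+1.
(** y = x ∪ {x} *)
Definition fSucc y x := ∀ 0 ∈ y.+1 ↔ 0 ∈ x.+1 ∨ 0 ≡ x.+1.
(** z = {x, y} *)
Definition fUPair z x y := ∀ 0 ∈ z.+1 ↔ 0 ≡ x.+1 ∨ 0 ≡ y.+1.
(** z = (x, y) = {{x}, {x, y}} *)
Definition fPair z x y :=
  ∃ ∃ fUPair 1 x.+2 x.+2 ∧ fUPair 0 x.+2 y.+2 ∧ fUPair z.+2 1 0.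
(** (x, y) ∈ f *)
Definition fPairIn x y f := ∃ fPair 0 x.+1 y.+1 ∧ 0 ∈ f.+1.

Definition fInductive w :=
  (∃ fEmpty 0 ∧ 0 ∈ w.+1) ∧
  (∀ 0 ∈ w.+1 → ∃ fSucc 0 1 ∧ 0 ∈ w.+2).
(** n is a natural number *)
Definition fNat n := ∀ fInductive 0 → n.+1 ∈ 0.
(** w = ω *)
Definition fOmega w := ∀ 0 ∈ w.+1 ↔ fNat 0.

(** n is an even natural number: some set e contains 0 and n and satisfies
    k + 1 ∈ e <-> k ∉ e for all k < n. *)
Definition fEven n :=
  fNat n ∧
  (∃ (∃ fEmpty 0 ∧ 0 ∈ 1) ∧
     (∀ 0 ∈ n.+2 → ∃ fSucc 0 1 ∧ (0 ∈ 2 ↔ ¬ 1 ∈ 2)) ∧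
     n.+1 ∈ 0).
Definition fOdd n := fNat n ∧ ¬ fEven n.

(** s is the restriction of a to n *)
Definition fRestr s a n :=
  ∀ 0 ∈ s.+1 ↔ 0 ∈ a.+1 ∧ (∃ ∃ 1 ∈ n.+3 ∧ fPair 2 1 0).

(** * The axioms of ZFC *)

Definition closure (n : nat) (p : form) : form := iter n fAll p.

Definition ax_ext := ∀ ∀ (∀ 0 ∈ 1 ↔ 0 ∈ 2) → 0 ≡ 1.
Definition ax_found := ∀ (∃ 0 ∈ 1) → ∃ 0 ∈ 1 ∧ (∀ 0 ∈ 1 → ¬ 0 ∈ 2).
Definition ax_pair := ∀ ∀ ∃ fUPair 0 1 2.
Definition ax_union := ∀ ∃ ∀ 0 ∈ 1 ↔ ∃ 0 ∈ 3 ∧ 1 ∈ 0.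
Definition ax_power := ∀ ∃ ∀ 0 ∈ 1 ↔ fSub 0 2.
Definition ax_inf := ∃ fInductive 0.
(** Every set of pairwise disjoint nonempty sets has a transversal. *)
Definition ax_choice :=
  ∀ (∀ 0 ∈ 1 → ∃ 0 ∈ 1) →
    (∀ ∀ 1 ∈ 2 → 0 ∈ 2 → (∃ 0 ∈ 2 ∧ 0 ∈ 1) → 1 ≡ 0) →
    ∃ ∀ 0 ∈ 2 → ∃ ∀ (0 ∈ 2 ∧ 0 ∈ 3) ↔ 0 ≡ 1.

(** In [p] the variable 0 is the element x, the variable 1 the set a and the
    others are parameters: ∀a ∃b ∀x (x ∈ b <-> x ∈ a ∧ p(x, a)). *)
Definition ax_sep (p : form) := ∀ ∃ ∀ 0 ∈ 1 ↔ 0 ∈ 2 ∧ ren (up S) p.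

(** In [p] the variable 0 is the value y, the variable 1 the argument x, the
    variable 2 the set a and the others are parameters: if p(x, y, a) is
    functional for x ∈ a then ∃b ∀y (y ∈ b <-> ∃x (x ∈ a ∧ p(x, y, a))). *)
Definition ax_repl (p : form) :=
  ∀ (∀ 0 ∈ 1 → ∀ ∀ ren S p → ren (up S) p → 1 ≡ 0) →
    ∃ ∀ 0 ∈ 1 ↔
      ∃ 0 ∈ 3 ∧ ren (fun k => match k with 0 => 1 | 1 => 0 | _ => k.+1 end) p.

Inductive ZFC : form -> Prop :=
| ZFC_ext : ZFC ax_ext
| ZFC_found : ZFC ax_found
| ZFC_pair : ZFC ax_pair
| ZFC_union : ZFC ax_union
| ZFC_power : ZFC ax_power
| ZFC_inf : ZFC ax_inf
| ZFC_choice : ZFC ax_choice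
| ZFC_sep n p : bounded n.+2 p -> ZFC (closure n (ax_sep p))
| ZFC_repl n p : bounded n.+3 p -> ZFC (closure n (ax_repl p)).

(** * Class games

    [X], [A] and [W] are formulas in the single free variable 0 and stand for
    the classes they define; [psi] is a formula in the variables 0 and 1 and,
    with a parameter p, stands for the class {u | psi(u, p)}.  Sequences are
    sets of ordered pairs. *)

(** f is a function from the set d to the class X *)
Definition fFun (X : form) f d :=
  (∀ 0 ∈ f.+1 → ∃ ∃ fPair 2 1 0 ∧ 1 ∈ d.+3 ∧ app1 X 0) ∧
  (∀ 0 ∈ d.+1 → ∃ ∀ fPairIn 2 0 f.+3 ↔ 0 ≡ 1).

(** a ∈ X^ω *)
Definition fPlay (X : form) a := ∃ fOmega 0 ∧ fFun X a.+1 0.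
(** s ∈ X^{<ω} *)
Definition fPosition (X : form) s := ∃ fNat 0 ∧ fFun X s.+1 0.

(** X is a proper class and A ⊆ X^ω. *)
Definition fProperClassGame (X A : form) :=
  ¬ (∃ ∀ 0 ∈ 1 ↔ app1 X 0) ∧
  (∀ app1 A 0 → fPlay X 0).

(** W ∩ X^ω is open in X^ω: every play in W has a finite initial segment all
    of whose extensions to plays are in W. *)
Definition fOpen (X W : form) :=
  ∀ fPlay X 0 ∧ app1 W 0 →
    ∃ fNat 0 ∧
      (∃ fRestr 0 2 1 ∧ (∀ fPlay X 0 ∧ fSub 1 0 → app1 W 0)).

(** Player I's winning class is A, player II's is its complement. *)
Definition fClopen (X A : form) := fOpen X A ∧ fOpen X (¬ A).

(** (s, x) ∈ {u | psi(u, p)} *)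
Definition fVal (psi : form) p s x :=
  ∃ fPair 0 s.+1 x.+1 ∧ app2 psi 0 p.+1.

(** {u | psi(u, p)} is a class function X^{<ω} → X. *)
Definition fStrategy (X psi : form) p :=
  (∀ app2 psi 0 p.+1 → ∃ ∃ fPair 2 1 0 ∧ fPosition X 1 ∧ app1 X 0) ∧
  (∀ fPosition X 0 → ∃ ∀ fVal psi p.+3 2 0 ↔ 0 ≡ 1).

(** In the play a, the move at each stage n with [turn n] is the one that
    {u | psi(u, p)} prescribes at the position a restricted to n. *)
Definition fFollows (psi : form) p (turn : nat -> form) a :=
  ∀ ∀ ∀ turn 2 ∧ fRestr 1 a.+3 2 ∧ fPairIn 2 0 a.+3 → fVal psi p.+3 1 0.

(** {u | psi(u, p)} is a winning strategy for the player who moves at the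
    stages [turn] and has the winning class W. *)
Definition fWinning (X W psi : form) (turn : nat -> form) p :=
  fStrategy X psi p ∧
  (∀ fPlay X 0 ∧ fFollows psi p.+1 turn 0 → app1 W 0).

(** Player I makes the moves with even index, player II those with odd
    index. *)
Definition fWinningI (X A psi : form) p := fWinning X A psi fEven p.
Definition fWinningII (X A psi : form) p := fWinning X (¬ A) psi fOdd p.

Definition fNoWinningStrategy (X A psi : form) :=
  ∀ ¬ fWinningI X A psi 0 ∧ ¬ fWinningII X A psi 0.

(* Main.v *)
(** By the completeness theorem it suffices to argue in an arbitrary model of ZFC.

    Player I first plays a code of a formula together with a value, and player
    II then chooses who moves first in the evaluation game of that formula. A
    code is a pair (v, C) of a name v and a set C of codes, its children. The
    player to move at (v, C) chooses a child and a set as the value of the name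
    of that child; he wants to reach a code from which the other player, now to
    move, does not win. Thus a code asserts "some child, for some value, is
    false", and a leaf ((i, j), ∅) may only be entered if the value of i is an
    element of the value of j. The first player who cannot move legally loses.
    Plays are decided at a finite stage since codes are well-founded.

    A winning strategy of player II decides the truth of every (standard)
    formula by its choice of the first player, so a definable one is refuted by
    diagonalization. A definable winning strategy of player I is refuted by
    letting it play against itself: the plays in which player II passes and does
    not pass lead to the same evaluation game with the roles exchanged. *)

Require Import Defs.
From mathcomp Require Import all_boot.
From Stdlib Require Import Classical ClassicalEpsilon FunctionalExtensionality
  PropExtensionality.
From Stdlib Require List.

Set Implicit Arguments.
Unset Strict Implicit.
Unset Printing Implicit Defensive.

Local Open Scope form_scope.

(** No formula defines truth of all codes, so the agreement between winning and truth is proved by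
    induction on an external formula, and only for positions reached under a given strategy.
    Legality, in contrast, is a first-order property of a single play; this is why the game is
    definable and provably clopen.

    The main obstacle is that a winning strategy only promises something about infinite plays that
    are sets of the model. Before anything can be concluded from it, such a play has to be built by
    recursion along the [omega] of the model, which may be nonstandard. Hence every relation that
    enters a recursion, an induction or a separation must be shown definable with parameters.

    The value in the first move supplies the self-reference: it holds the very code being played
    together with the parameter of the strategy, so no fixed-point lemma for codes is needed. A pass
    takes up one stage and thereby changes the parity of every later one. As it is legal at stage 1
    only, the analysis of the evaluation game starts at stage 2. *)

Definition scons (M : Type) (x : M) (rho : nat -> M) (k : nat) : M :=
  if k is k'.+1 then rho k' else x.
Local Notation "x .: rho" := (scons x rho) (at level 55, right associativity).

Fixpoint sat (M : Type) (E : M -> M -> Prop) (rho : nat -> M) (p : form) : Prop :=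
  match p with
  | fBot => False
  | fMem x y => E (rho x) (rho y)
  | fEq x y => rho x = rho y
  | fImp p q => sat E rho p -> sat E rho q
  | fAll p => forall x, sat E (x .: rho) p
  end.

(** * Renamings and free variables of formulas *)

Lemma ren_bounded n p r s : bounded n p ->
  (forall k, k < n -> r k = s k) -> ren r p = ren s p.
Proof.
elim: p n r s => [|x y|x y|p IHp q IHq|p IHp] n r s //=.
- by move=> /andP[hx hy] e; rewrite !e.
- by move=> /andP[hx hy] e; rewrite !e.
- by move=> /andP[hp hq] e; congr fImp; [apply: IHp hp e|apply: IHq hq e].
- move=> hp e; rewrite (IHp n.+1 (up r) (up s)) //.
  by case=> //= k hk; rewrite e.
Qed.

Lemma bounded_ren n m p r : bounded n p ->
  (forall k, k < n -> r k < m) -> bounded m (ren r p).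
Proof.
elim: p n m r => [|x y|x y|p IHp q IHq|p IHp] n m r //=.
- by move=> /andP[hx hy] e; rewrite !e.
- by move=> /andP[hx hy] e; rewrite !e.
- by move=> /andP[hp hq] e; apply/andP; split; [apply: IHp hp e|apply: IHq hq e].
- by move=> hp e; apply: (IHp n.+1) => //; case=> //= k hk; apply: e.
Qed.

Lemma bounded_le n m p : n <= m -> bounded n p -> bounded m p.
Proof.
elim: p n m => [|x y|x y|p IHp q IHq|p IHp] n m //= h.
- by move=> /andP[hx hy]; rewrite !(leq_trans _ h).
- by move=> /andP[hx hy]; rewrite !(leq_trans _ h).
- by move=> /andP[hp hq]; apply/andP; split; [apply: IHp h hp|apply: IHq h hq].
- exact: IHp.
Qed.

Lemma bounded_exists p : exists n, bounded n p.
Proof.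
elim: p => [|x y|x y|p [n hp] q [m hq]|p [n hp]] /=.
- by exists 0.
- by exists (maxn x.+1 y.+1); rewrite leq_maxl leq_maxr.
- by exists (maxn x.+1 y.+1); rewrite leq_maxl leq_maxr.
- by exists (maxn n m); rewrite (bounded_le (leq_maxl n m) hp) (bounded_le (leq_maxr n m) hq).
- by exists n; apply: bounded_le hp.
Qed.

Lemma ren_comp p r s : ren r (ren s p) = ren (r \o s) p.
Proof.
elim: p r s => [|x y|x y|p IHp q IHq|p IHp] r s //=.
- by rewrite IHp IHq.
- rewrite IHp; congr (fAll (ren _ p)).
  by apply: functional_extensionality; case.
Qed.

Lemma ren_id p : ren id p = p.
Proof.
elim: p => [|x y|x y|p IHp q IHq|p IHp] //=; first by rewrite IHp IHq.
rewrite -{2}IHp; congr (fAll (ren _ p)).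
by apply: functional_extensionality; case.
Qed.

Lemma ren_closed p r : bounded 0 p -> ren r p = p.
Proof. by move=> hp; rewrite -{2}(ren_id p); apply: (ren_bounded hp). Qed.

Lemma bounded_closure n m p : bounded (m + n) p -> bounded m (Defs.closure n p).
Proof.
rewrite /Defs.closure; elim: n m => [|n IHn] m; first by rewrite addn0.
by rewrite addnS -addSn => /IHn.
Qed.

Lemma ZFC_closed p : ZFC p -> bounded 0 p.
Proof.
case=> // {}n {}p hp; apply: bounded_closure; rewrite add0n /=.
- rewrite !andbT; have h : bounded n.+3 (ren (up S) p).
    by apply: (bounded_ren hp) => -[|[|k]].
  by rewrite h.
- have h1 : bounded n.+4 (ren S p) by apply: (bounded_ren hp).
  have h2 : bounded n.+4 (ren (up S) p) by apply: (bounded_ren hp) => -[|k].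
  set r := fun k => _.
  have h3 : bounded n.+4 (ren r p) by apply: (bounded_ren hp) => -[|[|k]].
  by rewrite h1 h2 h3.
Qed.

(** * Completeness of natural deduction *)

Section Completeness.

Variable T : form -> Prop.
Hypothesis Tclosed : forall p, T p -> bounded 0 p.

Lemma nd_weak G p : nd T G p -> forall G', List.incl G G' -> nd T G' p.
Proof.
elim=> {G p}.
- by move=> G p hp G' _; apply: nd_ax.
- by move=> G p hp G' h; apply: nd_hyp; apply: h.
- move=> G p q _ IH G' h; apply: nd_impI; apply: IH.
  by move=> x [<-|hx]; [left|right; apply: h].
- by move=> G p q _ IHp _ IHq G' h; apply: (nd_impE (p := p)); [apply: IHp|apply: IHq].
- move=> G p _ IH G' h; apply: nd_raa; apply: IH.
  by move=> x [<-|hx]; [left|right; apply: h].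
- by move=> G p _ IH G' h; apply: nd_allI; apply: IH; apply: List.incl_map.
- by move=> G p t _ IH G' h; apply: nd_allE; apply: IH.
- by move=> G x G' _; apply: nd_refl.
- by move=> G p x y _ IH1 _ IH2 G' h; apply: (nd_subst (x := x)); [apply: IH1|apply: IH2].
Qed.

Lemma ren_inst r t p : ren r (inst t p) = inst (r t) (ren (up r) p).
Proof.
rewrite /inst !ren_comp; congr ren.
by apply: functional_extensionality; case.
Qed.

(** Axioms are sentences and hence fixed by renamings. This lets variables take over the part that
    fresh constants have in Henkin's proof. *)
Lemma nd_ren G p : nd T G p -> forall r, nd T (List.map (ren r) G) (ren r p).
Proof.
elim=> {G p}.
- by move=> G p hp r; rewrite (ren_closed _ (Tclosed hp)); apply: nd_ax.
- by move=> G p hp r; apply: nd_hyp; apply: List.in_map.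
- by move=> G p q _ IH r; apply: nd_impI; apply: IH.
- by move=> G p q _ IHp _ IHq r; apply: (nd_impE (p := ren r p)); [apply: IHp|apply: IHq].
- by move=> G p _ IH r; apply: nd_raa; apply: IH.
- move=> G p _ IH r; apply: nd_allI; have := IH (up r).
  rewrite !List.map_map; congr nd; apply: List.map_ext => q.
  by rewrite !ren_comp; congr ren; apply: functional_extensionality; case.
- by move=> G p t _ IH r; rewrite ren_inst; apply: nd_allE; apply: IH.
- by move=> G x r; apply: nd_refl.
- move=> G p x y _ IH1 _ IH2 r; rewrite ren_inst; apply: (nd_subst (x := r x)) => //.
  by rewrite -ren_inst.
Qed.

(** The variable [t] is fresh, so the renaming that sends it to 0 and shifts all others turns a
    derivation of the instance into the premise of [nd_allI]. *)
Lemma nd_gen G t p : (forall q, List.In q G -> bounded t q) -> bounded t.+1 p ->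
  nd T G (inst t p) -> nd T G (∀ p).
Proof.
move=> hG hp h; apply: nd_allI.
pose r k := if k == t then 0 else k.+1.
have := nd_ren h r.
have -> : List.map (ren r) G = List.map (ren S) G.
  apply: List.map_ext_in => q /hG hq; apply: (ren_bounded hq) => k hk.
  by rewrite /r (ltn_eqF hk).
suff -> : ren r (inst t p) = p by [].
rewrite -{2}(ren_id p) /inst ren_comp; apply: (ren_bounded hp).
case=> [|k hk] /=; first by rewrite /r eqxx.
by rewrite /r (ltn_eqF (hk : k < t)).
Qed.

Definition con G := ~ nd T G fBot.

Lemma nd_bot G p : nd T G fBot -> nd T G p.
Proof. by move=> h; apply: nd_raa; apply: (nd_weak h) => x hx; right. Qed.

Lemma nd_cut G p q : nd T G p -> nd T (p :: G) q -> nd T G q.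
Proof. by move=> hp hq; apply: (nd_impE (p := p)) => //; apply: nd_impI. Qed.

Lemma not_con_neg G p : ~ con (p :: G) -> nd T G (¬ p).
Proof. by move=> /NNPP h; apply: nd_impI. Qed.

Lemma con_neg G p : con G -> ~ con (p :: G) -> con ((¬ p) :: G).
Proof. by move=> hG /not_con_neg hp h; apply: hG; apply: nd_cut h. Qed.

(** If the negated fresh instance were inconsistent, the instance would be derivable and [nd_gen]
    would yield [∀ p]. *)
Lemma con_witness G t p : (forall q, List.In q G -> bounded t q) -> bounded t.+1 p ->
  con ((¬ (∀ p)) :: G) -> con ((¬ inst t p) :: (¬ (∀ p)) :: G).
Proof.
move=> hG hp hc h; apply: hc.
apply: (nd_impE (p := (∀ p))); first by apply: nd_hyp; left.
apply: (nd_gen (t := t)) => //; last exact: nd_raa.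
move=> q [<-|]; last exact: hG.
by rewrite /= hp.
Qed.

Fixpoint enc (p : form) : GenTree.tree nat :=
  match p with
  | fBot => GenTree.Leaf 0
  | fMem x y => GenTree.Node 0 [:: GenTree.Leaf x; GenTree.Leaf y]
  | fEq x y => GenTree.Node 1 [:: GenTree.Leaf x; GenTree.Leaf y]
  | fImp p q => GenTree.Node 2 [:: enc p; enc q]
  | fAll p => GenTree.Node 3 [:: enc p]
  end.

Fixpoint dec (u : GenTree.tree nat) : form :=
  match u with
  | GenTree.Node 0 [:: GenTree.Leaf x; GenTree.Leaf y] => fMem x y
  | GenTree.Node 1 [:: GenTree.Leaf x; GenTree.Leaf y] => fEq x y
  | GenTree.Node 2 [:: u; v] => fImp (dec u) (dec v)
  | GenTree.Node 3 [:: u] => fAll (dec u)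
  | _ => fBot
  end.

Lemma encK : cancel enc dec.
Proof. by elim=> //= [p -> q ->|p ->]. Qed.

Definition enum_form (k : nat) : form :=
  if unpickle k is Some u then dec u else fBot.

Lemma enum_formP p : exists k, enum_form k = p.
Proof. by exists (pickle (enc p)); rewrite /enum_form pickleK encK. Qed.

Lemma fresh_exists G p : exists t, (forall q, List.In q G -> bounded t q) /\ bounded t.+1 p.
Proof.
elim: G => [|q G [t [hG hp]]].
  by have [n hn] := bounded_exists p; exists n; split=> //; apply: bounded_le hn.
have [n hn] := bounded_exists q; exists (maxn n t); split.
  move=> q' [<-|/hG]; first by apply: bounded_le hn; apply: leq_maxl.
  by apply: bounded_le; apply: leq_maxr.
by apply: bounded_le hp; rewrite ltnS leq_maxr.
Qed.

Definition fresh G p : nat :=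
  proj1_sig (constructive_indefinite_description _ (fresh_exists G p)).

Lemma freshP G p :
  (forall q, List.In q G -> bounded (fresh G p) q) /\ bounded (fresh G p).+1 p.
Proof. by rewrite /fresh; case: constructive_indefinite_description. Qed.

(** Lindenbaum's and Henkin's constructions in one pass: a rejected universal formula receives its
    counterexample at once. Every stage is a finite list, so a fresh variable is always
    available. *)
Fixpoint henkin (G0 : list form) (k : nat) : list form :=
  if k is k'.+1 then
    let G := henkin G0 k' in
    let p := enum_form k' in
    if excluded_middle_informative (con (p :: G)) then p :: G
    else if p is fAll q then (¬ inst (fresh G q) q) :: (¬ p) :: G
    else (¬ p) :: G
  else G0.

Variable G0 : list form.
Hypothesis conG0 : con G0.

Lemma con_henkin k : con (henkin G0 k).
Proof.
elim: k => //= k IH; case: excluded_middle_informative => // h.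
have hn := con_neg IH h.
case: (enum_form k) hn h => // q hn h.
by have [h1 h2] := freshP (henkin G0 k) q; apply: con_witness.
Qed.

Lemma henkin_incl k l : k <= l -> List.incl (henkin G0 k) (henkin G0 l).
Proof.
move=> /subnKC <-; elim: (l - k) => [|m IH]; first by rewrite addn0.
rewrite addnS /= => x /IH hx; case: excluded_middle_informative => ? /=; first by right.
by case: (enum_form _) => [|? ?|? ?|? ?|?]; right => //; right.
Qed.

Definition thy p := exists k, nd T (henkin G0 k) p.

Lemma thy_total p : thy p \/ thy (¬ p).
Proof.
have [k <-] := enum_formP p.
have : List.In (enum_form k) (henkin G0 k.+1) \/ List.In (¬ (enum_form k)) (henkin G0 k.+1).
  rewrite /=; case: excluded_middle_informative => ? /=; first by left; left.
  by right; case: (enum_form k) => [|? ?|? ?|? ?|?]; [left|left|left|left|right; left].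
by case=> h; [left|right]; exists k.+1; apply: nd_hyp.
Qed.

Lemma thy_mp p q : thy (p → q) -> thy p -> thy q.
Proof.
move=> [k hk] [l hl]; exists (maxn k l); apply: (nd_impE (p := p)).
  by apply: nd_weak hk _ _; apply: henkin_incl; apply: leq_maxl.
by apply: nd_weak hl _ _; apply: henkin_incl; apply: leq_maxr.
Qed.

Lemma thy_bot : ~ thy fBot.
Proof. by case=> k; apply: con_henkin. Qed.

Lemma thy_imp p q : thy (p → q) <-> (thy p -> thy q).
Proof.
split; first exact: thy_mp.
move=> h; case: (thy_total p) => [/h [k hk]|[k hk]]; exists k; apply: nd_impI.
  by apply: nd_weak hk _ _ => x; right.
apply: nd_bot; apply: (nd_impE (p := p)); last by apply: nd_hyp; left.
by apply: nd_weak hk _ _ => x; right.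
Qed.

Lemma thy_all p : thy (∀ p) <-> forall t, thy (inst t p).
Proof.
split; first by move=> [k hk] t; exists k; apply: nd_allE.
move=> h; apply: NNPP => hn.
(* At the stage where [∀ p] is enumerated it must have been rejected, so a negated instance was
   added there. *)
have [k ek] := enum_formP (∀ p).
have : ~ con (enum_form k :: henkin G0 k).
  rewrite ek => hc; apply: hn; rewrite -ek; exists k.+1; apply: nd_hyp => /=.
  rewrite ek; by case: excluded_middle_informative => // ? /=; left.
move=> hc.
have hw : thy (¬ inst (fresh (henkin G0 k) p) p).
  exists k.+1; apply: nd_hyp => /=; case: excluded_middle_informative => // ? /=.
  by rewrite ek; left.
exact: thy_bot (thy_mp hw (h _)).
Qed.

Lemma thy_refl x : thy (x ≡ x).
Proof. by exists 0; apply: nd_refl. Qed.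

Lemma thy_subst p x y : thy (x ≡ y) -> thy (inst x p) -> thy (inst y p).
Proof.
move=> [k hk] [l hl]; exists (maxn k l); apply: (nd_subst (x := x)).
  by apply: nd_weak hk _ _; apply: henkin_incl; apply: leq_maxl.
by apply: nd_weak hl _ _; apply: henkin_incl; apply: leq_maxr.
Qed.

Lemma thy_sym x y : thy (x ≡ y) -> thy (y ≡ x).
Proof. by move=> h; apply: (@thy_subst (0 ≡ x.+1) x y h); apply: thy_refl. Qed.

Lemma thy_trans x y z : thy (x ≡ y) -> thy (y ≡ z) -> thy (x ≡ z).
Proof. by move=> h1 h2; apply: (@thy_subst (x.+1 ≡ 0) y z h2). Qed.

(** A canonical member of each class of provably equal variables. The term model consists of the
    fixed points of [rep], so that [≡] can be interpreted by equality as [sat] demands. *)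
Definition rep (x : nat) : nat := epsilon (inhabits 0) (fun y => thy (x ≡ y)).

Lemma repP x : thy (x ≡ rep x).
Proof.
exact: (epsilon_spec (inhabits 0) (fun y => thy (x ≡ y)) (ex_intro _ x (thy_refl x))).
Qed.

Lemma rep_eq x y : rep x = rep y <-> thy (x ≡ y).
Proof.
split=> [e|h].
  by apply: thy_trans (repP x) _; rewrite e; apply: thy_sym; apply: repP.
rewrite /rep; congr epsilon; apply: functional_extensionality => z.
apply: propositional_extensionality; split; first exact: thy_trans (thy_sym h).
exact: thy_trans.
Qed.

Definition termModel := {x : nat | rep x == x}.

Lemma rep_rep x : rep (rep x) == rep x.
Proof. by apply/eqP/rep_eq; apply: thy_sym; apply: repP. Qed.

Definition cls (x : nat) : termModel := exist _ (rep x) (rep_rep x).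

Lemma cls_eq x y : cls x = cls y <-> thy (x ≡ y).
Proof.
rewrite -rep_eq; split=> [[]//|e].
by apply: eq_exist_uncurried; exists e; apply: bool_irrelevance.
Qed.

Lemma cls_surj (u : termModel) : cls (sval u) = u.
Proof.
case: u => x hx /=; apply: eq_exist_uncurried; exists (eqP hx).
exact: bool_irrelevance.
Qed.

Definition termMem (u v : termModel) := thy (sval u ∈ sval v).

Lemma termMemP x y : termMem (cls x) (cls y) <-> thy (x ∈ y).
Proof.
rewrite /termMem /=; split=> h.
  apply: (@thy_subst (0 ∈ y.+1) (rep x) x); first by apply: thy_sym; apply: repP.
  by apply: (@thy_subst ((rep x).+1 ∈ 0) (rep y) y); first by apply: thy_sym; apply: repP.
apply: (@thy_subst (0 ∈ (rep y).+1) x (rep x)); first exact: repP.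
by apply: (@thy_subst (x.+1 ∈ 0) y (rep y)); first exact: repP.
Qed.

(** The induction runs over all renamings [r]: extending [cls \o r] under a quantifier gives an
    environment of the same form, and by [cls_surj] the added values exhaust the model. *)
Lemma truth p r : sat termMem (cls \o r) p <-> thy (ren r p).
Proof.
elim: p r => [|x y|x y|p IHp q IHq|p IHp] r /=.
- by split=> // /thy_bot.
- exact: termMemP.
- exact: cls_eq.
- by rewrite thy_imp IHp IHq.
- rewrite thy_all.
  have e t : inst t (ren (up r) p) = ren (t .: r) p.
    by rewrite /inst ren_comp; congr ren; apply: functional_extensionality; case.
  have e' t : cls \o (t .: r) = cls t .: (cls \o r).
    by apply: functional_extensionality; case.
  split=> h t; first by rewrite e -IHp e'; apply: h.
  by rewrite -(cls_surj t) -e' IHp -e; apply: h.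
Qed.

End Completeness.

Theorem completeness (T : form -> Prop) (p : form) :
  (forall q, T q -> bounded 0 q) ->
  (forall (M : Type) (E : M -> M -> Prop), inhabited M ->
     (forall q, T q -> forall rho, sat E rho q) -> forall rho, sat E rho p) ->
  provable T p.
Proof.
move=> hT h; apply: nd_raa; apply: NNPP => hc.
have hM q : T q -> forall rho, sat (@termMem T [:: (¬ p)]) rho q.
  move=> hq rho.
  have -> : rho = cls T [:: (¬ p)] \o (fun k => sval (rho k)).
    by apply: functional_extensionality => k; rewrite /= cls_surj.
  rewrite truth // ren_closed; last exact: hT.
  by exists 0; apply: nd_ax.
have := h _ _ (inhabits (cls T [:: (¬ p)] 0)) hM (cls T [:: (¬ p)] \o id).
rewrite truth // ren_id => h1.
have h2 : thy T [:: (¬ p)] (¬ p) by exists 0; apply: nd_hyp; left.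
exact: thy_bot hc (thy_mp h2 h1).
Qed.

(** * Satisfaction of compound and renamed formulas *)

Section Satisfaction.

Variables (M : Type) (E : M -> M -> Prop).
Implicit Types (rho : nat -> M) (p q : form).

Lemma sat_not rho p : sat E rho (¬ p) <-> ~ sat E rho p.
Proof. by []. Qed.

Lemma sat_and rho p q : sat E rho (p ∧ q) <-> sat E rho p /\ sat E rho q.
Proof.
split=> /= [h|[hp hq] h]; last exact: h.
by split; apply: NNPP => hn; apply: h => hp //; move=> hq; apply: hn.
Qed.

Lemma sat_or rho p q : sat E rho (p ∨ q) <-> sat E rho p \/ sat E rho q.
Proof.
split=> /= [h|[hp|hq] h] //.
by case: (classic (sat E rho p)) => [|/h]; [left|right].
Qed.

Lemma sat_imp rho p q : sat E rho (p → q) <-> (sat E rho p -> sat E rho q).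
Proof. by []. Qed.

Lemma sat_iff rho p q : sat E rho (p ↔ q) <-> (sat E rho p <-> sat E rho q).
Proof. by rewrite /fIff sat_and. Qed.

Lemma sat_all rho p : sat E rho (∀ p) <-> forall x, sat E (x .: rho) p.
Proof. by []. Qed.

Lemma sat_ex rho p : sat E rho (∃ p) <-> exists x, sat E (x .: rho) p.
Proof.
split=> /= [h|[x hx] h]; last exact: h hx.
by apply: NNPP => hn; apply: h => x hx; apply: hn; exists x.
Qed.

Lemma scons_up x rho r : (x .: rho) \o up r = x .: (rho \o r).
Proof. by apply: functional_extensionality; case. Qed.

Lemma sat_ren rho r p : sat E rho (ren r p) <-> sat E (rho \o r) p.
Proof.
elim: p rho r => [|x y|x y|p IHp q IHq|p IHp] rho r //=; first by rewrite IHp IHq.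
by split=> h x; have := h x; rewrite IHp scons_up.
Qed.

Lemma sat_congr rho rho' p : rho = rho' -> (sat E rho p <-> sat E rho' p).
Proof. by move=> ->. Qed.

Lemma sat_closure n p :
  (forall rho, sat E rho (Defs.closure n p)) -> forall rho, sat E rho p.
Proof.
elim: n p => // n IH p; rewrite /Defs.closure iterSr => /IH h rho.
have -> : rho = rho 0 .: (fun k => rho k.+1) by apply: functional_extensionality; case.
exact: h.
Qed.

Definition env2 (x y : M) (k : nat) : M := if k is 0 then x else y.

Lemma sat_app1 rho p x : sat E rho (app1 p x) <-> sat E (fun=> rho x) p.
Proof. exact: sat_ren. Qed.

Lemma sat_app2 rho p x y : sat E rho (app2 p x y) <-> sat E (env2 (rho x) (rho y)) p.
Proof.
rewrite /app2 sat_ren; apply: sat_congr.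
by apply: functional_extensionality; case.
Qed.

End Satisfaction.

Structure zfModel := ZfModel {
  domain :> Type;
  elt : domain -> domain -> Prop;
  nonempty : inhabited domain;
  zf_axioms : forall p, ZFC p -> forall rho, sat elt rho p
}.

(** * Definability with parameters *)

Section Definability.

Variable M : zfModel.
Local Notation E := (@elt M).
Local Notation inhM := (nonempty M).
Implicit Types (rho : nat -> M) (P Q : (nat -> M) -> Prop).

(* The parameters occupy the odd variables. *)
Definition mix (rho pi : nat -> M) (k : nat) : M :=
  if odd k then pi k./2 else rho k./2.

(** A semantic notion with an infinite supply of parameters. It is closed under connectives,
    quantifiers and definable terms, so instances of the schemes are obtained for Rocq predicates
    without writing the formula. *)
Definition dfn P := exists p pi, forall rho, P rho <-> sat E (mix rho pi) p.

Definition dterm (f : (nat -> M) -> M) := dfn (fun rho => rho 0 = f (fun k => rho k.+1)).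

Definition value (t : nat + M) rho : M :=
  match t with inl i => rho i | inr c => c end.

Lemma mix_even rho pi k : mix rho pi k.*2 = rho k.
Proof. by rewrite /mix odd_double doubleK. Qed.

Lemma mix_odd rho pi k : mix rho pi k.*2.+1 = pi k.
Proof. by rewrite /mix /= odd_double uphalf_double. Qed.

Lemma mixE rho pi k : mix rho pi k = if odd k then pi k./2 else rho k./2.
Proof. by []. Qed.

Lemma dfn_subst P (t : nat -> nat + M) : dfn P ->
  dfn (fun rho => P (fun k => value (t k) rho)).
Proof.
case: inhM => c0 [p [pi h]].
(* The old parameters take the even places of the new parameter sequence, the constants of [t] the
   odd ones. *)
exists (ren (fun k => if odd k then k./2.*2.*2.+1
         else match t k./2 with inl i => i.*2 | inr _ => k./2.*2.+1.*2.+1 end) p).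
exists (mix pi (fun k => if t k is inr c then c else c0)) => rho.
rewrite h sat_ren; apply: sat_congr; apply: functional_extensionality => k /=.
rewrite mixE; case: (odd k); first by rewrite mix_odd mix_even.
by case e: (t k./2) => [i|c] /=; rewrite ?mix_even ?mix_odd ?e.
Qed.

Lemma dfn_ext P Q : (forall rho, P rho <-> Q rho) -> dfn P -> dfn Q.
Proof. by move=> e [p [pi h]]; exists p, pi => rho; rewrite -e h. Qed.

Lemma dfn_satv p : dfn (fun rho => sat E rho p).
Proof.
case: inhM => c.
exists (ren (fun k => k.*2) p), (fun=> c) => rho; rewrite sat_ren.
suff -> : mix rho (fun=> c) \o (fun k => k.*2) = rho by [].
by apply: functional_extensionality => k /=; rewrite mix_even.
Qed.

Lemma dfn_cst (A : Prop) : dfn (fun=> A).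
Proof.
case: inhM => c; case: (classic A) => hA.
  by exists (fImp fBot fBot), (fun=> c) => rho /=; tauto.
by exists fBot, (fun=> c) => rho /=; tauto.
Qed.

Lemma dfn_imp P Q : dfn P -> dfn Q -> dfn (fun rho => P rho -> Q rho).
Proof.
move=> [p [pi hp]] [q [tau hq]].
exists (fImp (ren (fun k => if odd k then k./2.*2.*2.+1 else k) p)
             (ren (fun k => if odd k then k./2.*2.+1.*2.+1 else k) q)).
exists (mix pi tau) => rho; rewrite sat_imp !sat_ren hp hq.
have -> : mix rho (mix pi tau) \o (fun k => if odd k then k./2.*2.*2.+1 else k) = mix rho pi.
  apply: functional_extensionality => k /=; rewrite [RHS]mixE.
  by case: ifP => [_|e]; [rewrite mix_odd mix_even|rewrite mixE e].
have -> // : mix rho (mix pi tau) \o (fun k => if odd k then k./2.*2.+1.*2.+1 else k) = mix rho tau.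
apply: functional_extensionality => k /=; rewrite [RHS]mixE.
by case: ifP => [_|e]; [rewrite !mix_odd|rewrite mixE e].
Qed.

Lemma dfn_not P : dfn P -> dfn (fun rho => ~ P rho).
Proof. by move=> h; apply: dfn_imp => //; apply: dfn_cst. Qed.

Lemma dfn_and P Q : dfn P -> dfn Q -> dfn (fun rho => P rho /\ Q rho).
Proof.
move=> hp hq; apply: (dfn_ext (P := fun rho => ~ (P rho -> ~ Q rho))); last first.
  by apply/dfn_not/dfn_imp => //; apply: dfn_not.
by move=> rho; tauto.
Qed.

Lemma dfn_or P Q : dfn P -> dfn Q -> dfn (fun rho => P rho \/ Q rho).
Proof.
move=> hp hq; apply: (dfn_ext (P := fun rho => ~ P rho -> Q rho)); last first.
  by apply: dfn_imp => //; apply: dfn_not.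
by move=> rho; tauto.
Qed.

Lemma dfn_iff P Q : dfn P -> dfn Q -> dfn (fun rho => P rho <-> Q rho).
Proof. by move=> hp hq; apply: dfn_and; apply: dfn_imp. Qed.

Lemma dfn_all (P : M -> (nat -> M) -> Prop) :
  dfn (fun rho => P (rho 0) (fun k => rho k.+1)) -> dfn (fun rho => forall x, P x rho).
Proof.
move=> [p [pi h]].
(* The binder moves the whole mixed environment up by one, whereas putting [x] in front of [rho]
   before mixing moves only the even variables, by two. The renaming corrects the difference. *)
exists (∀ (ren (fun k => if k is 0 then 0 else if odd k then k.+1 else k.-1) p)), pi => rho.
rewrite sat_all; suff e x : P x rho <-> sat E (x .: mix rho pi)
  (ren (fun k => if k is 0 then 0 else if odd k then k.+1 else k.-1) p).
  by split=> hx x; apply/e.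
rewrite sat_ren -[P x rho]/(P ((x .: rho) 0) (fun k => (x .: rho) k.+1)) h.
suff -> : mix (x .: rho) pi = (x .: mix rho pi) \o
   (fun k => if k is 0 then 0 else if odd k then k.+1 else k.-1) by [].
apply: functional_extensionality => -[|k] //; rewrite -(odd_double_half k).
case: (odd k); rewrite ?add0n ?add1n.
  by rewrite -doubleS mix_even /= odd_double /= mix_even.
by rewrite mix_odd /= odd_double /= mix_odd.
Qed.

Lemma dfn_ex (P : M -> (nat -> M) -> Prop) :
  dfn (fun rho => P (rho 0) (fun k => rho k.+1)) -> dfn (fun rho => exists x, P x rho).
Proof.
move=> h; apply: (dfn_ext (P := fun rho => ~ forall x, ~ P x rho)).
  move=> rho; split=> [hn|[x hx] hn]; last exact: hn hx.
  by apply: NNPP => hx; apply: hn => x hp; apply: hx; exists x.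
by apply/dfn_not/(@dfn_all (fun x rho => ~ P x rho))/dfn_not.
Qed.

Lemma dterm_var i : dterm (fun rho => rho i).
Proof. exact: (dfn_satv (0 ≡ i.+1)). Qed.

Lemma dterm_cst c : dterm (fun=> c).
Proof.
exact: (dfn_subst (fun k => if k is 0 then inl 0 else inr c) (dfn_satv (0 ≡ 1))).
Qed.

Lemma dfn_let (f : (nat -> M) -> M) (P : M -> (nat -> M) -> Prop) : dterm f ->
  dfn (fun rho => P (rho 0) (fun k => rho k.+1)) -> dfn (fun rho => P (f rho) rho).
Proof.
move=> hf hP; apply: (dfn_ext (P := fun rho => exists x, x = f rho /\ P x rho)).
  by move=> rho; split=> [[x [->]]|hx] //; exists (f rho).
by apply: (@dfn_ex (fun x rho => x = f rho /\ P x rho)); apply: dfn_and.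
Qed.

Lemma dterm_weak f : dterm f -> dterm (fun rho => f (fun k => rho k.+1)).
Proof. exact: (dfn_subst (fun k => if k is k'.+1 then inl k'.+2 else inl 0)). Qed.

Lemma dfn_sel P (i : nat -> nat) : dfn P -> dfn (fun rho => P (fun k => rho (i k))).
Proof. exact: (dfn_subst (fun k => inl (i k))). Qed.

Lemma dfn_app1 (Q : M -> Prop) f : dfn (fun rho => Q (rho 0)) -> dterm f ->
  dfn (fun rho => Q (f rho)).
Proof. by move=> hQ hf; apply: (dfn_let (P := fun x _ => Q x) hf hQ). Qed.

Lemma dfn_app2 (Q : M -> M -> Prop) f g : dfn (fun rho => Q (rho 0) (rho 1)) ->
  dterm f -> dterm g -> dfn (fun rho => Q (f rho) (g rho)).
Proof.
move=> hQ hf hg; apply: (dfn_let (P := fun x rho => Q x (g rho)) hf).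
apply: (dfn_let (P := fun y rho => Q (rho 0) y) (f := fun rho => g (fun k => rho k.+1))).
  exact: dterm_weak.
exact: (dfn_sel (fun k => if k is 0 then 1 else 0) hQ).
Qed.

Lemma dfn_app3 (Q : M -> M -> M -> Prop) f g h :
  dfn (fun rho => Q (rho 0) (rho 1) (rho 2)) ->
  dterm f -> dterm g -> dterm h -> dfn (fun rho => Q (f rho) (g rho) (h rho)).
Proof.
move=> hQ hf hg hh; apply: (dfn_let (P := fun x rho => Q x (g rho) (h rho)) hf).
apply: (dfn_let (P := fun y rho => Q (rho 0) y (h (fun k => rho k.+1)))
  (f := fun rho => g (fun k => rho k.+1))); first exact: dterm_weak.
apply: (dfn_let (P := fun y rho => Q (rho 1) (rho 0) y)
  (f := fun rho => h (fun k => rho k.+2))); first exact: dterm_weak (dterm_weak hh).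
exact: (dfn_sel (fun k => match k with 0 => 2 | 1 => 1 | _ => 0 end) hQ).
Qed.

Lemma dterm_app1 (F : M -> M) f : dterm (fun rho => F (rho 0)) -> dterm f ->
  dterm (fun rho => F (f rho)).
Proof.
move=> hF hf; apply: (dfn_app2 (Q := fun x y => x = F y)) => //.
  exact: dterm_var.
exact: dterm_weak.
Qed.

Lemma dterm_app2 (F : M -> M -> M) f g : dterm (fun rho => F (rho 0) (rho 1)) ->
  dterm f -> dterm g -> dterm (fun rho => F (f rho) (g rho)).
Proof.
move=> hF hf hg; apply: (dfn_app3 (Q := fun x y z => x = F y z)) => //.
- exact: dterm_var.
- exact: dterm_weak.
- exact: dterm_weak.
Qed.

Lemma dfn_mem f g : dterm f -> dterm g -> dfn (fun rho => E (f rho) (g rho)).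
Proof. exact: (dfn_app2 (dfn_satv (0 ∈ 1))). Qed.

Lemma dfn_eq f g : dterm f -> dterm g -> dfn (fun rho => f rho = g rho).
Proof. exact: (dfn_app2 (dfn_satv (0 ≡ 1))). Qed.

Lemma dfn_env2 p f g : dterm f -> dterm g -> dfn (fun rho => sat E (env2 (f rho) (g rho)) p).
Proof.
apply: (@dfn_app2 (fun x y => sat E (env2 x y) p)).
apply: (dfn_ext (P := fun rho => sat E rho (app2 p 0 1))); last exact: dfn_satv.
by move=> rho; rewrite sat_app2.
Qed.

End Definability.

(** * Set theory in a model *)

Ltac dfn_user := fail.
Ltac dfn_step := cbv beta; first
  [ simple apply dfn_cst | simple apply dterm_cst | simple apply dterm_var
  | dfn_user
  | simple apply dfn_eq | simple apply dfn_mem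
  | simple apply dfn_not | simple apply dfn_iff | simple apply dfn_and
  | simple apply dfn_or | simple apply dfn_ex | simple apply dfn_imp | simple apply dfn_all ].
Ltac solve_dfn := repeat dfn_step.

Section Sets.

Variable M : zfModel.
Local Notation "x 'ε' y" := (@elt M x y) (at level 70).
Implicit Types (a b c u v w x y z : M).

Lemma set_ext x y : (forall z, z ε x <-> z ε y) -> x = y.
Proof.
move=> h; have /sat_all/(_ y)/sat_all/(_ x)/sat_imp := zf_axioms ZFC_ext (fun=> x).
by apply; apply/sat_all => z; apply/sat_iff; apply: h.
Qed.

Lemma foundation a : (exists x, x ε a) -> exists x, x ε a /\ forall y, y ε x -> ~ y ε a.
Proof.
move=> [c hc]; have /sat_all/(_ a)/sat_imp := zf_axioms ZFC_found (fun=> a).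
rewrite !sat_ex; case; first by exists c.
by move=> x /sat_and[hx hy]; exists x.
Qed.

Lemma separation (P : M -> Prop) a : dfn (fun rho => P (rho 0)) ->
  exists b, forall x, x ε b <-> x ε a /\ P x.
Proof.
move=> [p [pi hp]].
(* [P] reads only [rho 0], so every even variable may be sent to the element; the parameters are
   shifted past the element and the set. *)
pose q := ren (fun k => if odd k then k./2.+2 else 0) p.
have [n hn] := bounded_exists q.
have hn2 : bounded n.+2 q by apply: bounded_le hn; rewrite -addn2 leq_addr.
have /(_ pi)/sat_all/(_ a)/sat_ex[b /sat_all hb] := sat_closure (@zf_axioms M _ (ZFC_sep hn2)).
exists b => x.
have /sat_iff h := hb x; apply: iff_trans h _; rewrite sat_and sat_ren.
apply: and_iff_compat_l.
rewrite (hp (fun=> x)) sat_ren; apply: sat_congr.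
by apply: functional_extensionality => k /=; rewrite /mix; case: (odd k).
Qed.

Lemma replacement (R : M -> M -> Prop) a : dfn (fun rho => R (rho 0) (rho 1)) ->
  (forall x y y', x ε a -> R x y -> R x y' -> y = y') ->
  exists b, forall y, y ε b <-> exists x, x ε a /\ R x y.
Proof.
move=> [p [pi hp]] hf.
(* [R] reads only [rho 0] and [rho 1]: variable 0 becomes the argument, every other even variable
   the value. *)
pose q := ren (fun k => if odd k then k./2.+3 else if k is 0 then 1 else 0) p.
have [n hn] := bounded_exists q.
have hn3 : bounded n.+3 q by apply: bounded_le hn; rewrite -addn3 leq_addr.
have hq x y : sat (@elt M) (y .: (x .: (a .: pi))) q <-> R x y.
  rewrite (hp (x .: (fun=> y))) sat_ren; apply: sat_congr.
  apply: functional_extensionality => k /=; rewrite /mix.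
  by case: k => // k; case e: (odd k.+1) => //=; case: k e.
have /(_ pi)/sat_all/(_ a)/sat_imp := sat_closure (@zf_axioms M _ (ZFC_repl hn3)).
case/(_ _)/sat_ex.
  apply/sat_all => x; apply/sat_imp => hx; apply/sat_all => y; apply/sat_all => y'.
  apply/sat_imp; rewrite sat_ren => h1; apply/sat_imp; rewrite sat_ren => h2 /=.
  apply: (hf x y y' hx); apply/hq; first exact: h1.
  apply: (iffLR (sat_congr (elt (z:=M)) _ _) h2).
  by apply: functional_extensionality => -[|k].
move=> b /sat_all hb; exists b => y; have /sat_iff h := hb y; apply: iff_trans h _; rewrite sat_ex.
have e x : sat (@elt M) (x .: (y .: (b .: (a .: pi)))) (ren (fun k : nat => match k with
                                | 0 => 1 | 1 => 0 | _ => k.+1 end) q) <-> R x y.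
  rewrite sat_ren -hq; apply: sat_congr.
  by apply: functional_extensionality => -[|[|]].
by split=> -[x]; [move/sat_and=> [hx /e h]; exists x|move=> [hx /e h]; exists x; apply/sat_and].
Qed.

(** The choice is made outside the model. Definability of an operation introduced in this way is
    recovered afterwards from the property that characterises its value. *)
Definition the (P : M -> Prop) : M := epsilon (nonempty M) P.

Lemma theP (P : M -> Prop) : (exists x, P x) -> P (the P).
Proof. exact: epsilon_spec. Qed.

Definition upair x y := the (fun z => forall w, w ε z <-> w = x \/ w = y).

Lemma upairP x y w : w ε upair x y <-> w = x \/ w = y.
Proof.
apply: (theP (P := fun z => forall w, w ε z <-> w = x \/ w = y)).
have /sat_all/(_ y)/sat_all/(_ x)/sat_ex[z /sat_all hz] := zf_axioms ZFC_pair (fun=> x).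
by exists z => v; have /sat_iff := hz v; rewrite sat_or.
Qed.

Definition union a := the (fun z => forall w, w ε z <-> exists y, y ε a /\ w ε y).

Lemma unionP a w : w ε union a <-> exists y, y ε a /\ w ε y.
Proof.
apply: (theP (P := fun z => forall w, w ε z <-> exists y, y ε a /\ w ε y)).
have /sat_all/(_ a)/sat_ex[z /sat_all hz] := zf_axioms ZFC_union (fun=> a).
exists z => v; have /sat_iff h := hz v; apply: iff_trans h _; rewrite sat_ex.
by split=> -[y]; [move/sat_and|move=> h]; exists y => //; apply/sat_and.
Qed.

Definition emp := the (fun z => forall w, ~ w ε z).

Lemma empP w : ~ w ε emp.
Proof.
apply: (theP (P := fun z => forall w, ~ w ε z)).
have [|b hb] := @separation (fun=> False) w; first by solve_dfn.
by exists b => x /hb[].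
Qed.

Definition op x y := upair (upair x x) (upair x y).
Definition sc x := union (upair x (upair x x)).

Lemma scP x w : w ε sc x <-> w ε x \/ w = x.
Proof.
rewrite unionP; split.
  by move=> [y [/upairP[->|->]]]; [left|move=> /upairP[]; right].
by move=> [h|->]; [exists x|exists (upair x x)]; rewrite !upairP; auto.
Qed.

Lemma upair_inj x y z w : upair x y = upair z w -> (x = z /\ y = w) \/ (x = w /\ y = z).
Proof.
move=> e.
have h v : v = x \/ v = y <-> v = z \/ v = w by rewrite -!upairP e.
have := h x; have := h y; have := h z; have := h w.
intuition (subst; auto).
Qed.

Lemma op_inj x y x' y' : op x y = op x' y' -> x = x' /\ y = y'.
Proof.
move=> /upair_inj[[/upair_inj h /upair_inj h']|[/upair_inj h /upair_inj h']];
intuition congruence.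
Qed.

Lemma emp_eq x : (forall w, ~ w ε x) -> x = emp.
Proof. by move=> h; apply: set_ext => z; split=> [/h|/empP]. Qed.

Lemma op_neq_emp x y : op x y <> emp.
Proof. by move=> e; apply: (@empP (upair x x)); rewrite -e; apply/upairP; left. Qed.

Lemma sc_neq_emp x : sc x <> emp.
Proof. by move=> e; apply: (@empP x); rewrite -e; apply/scP; right. Qed.

Lemma irrefl x : ~ x ε x.
Proof.
move=> h; have [|y [/upairP hy hm]] := @foundation (upair x x).
  by exists x; apply/upairP; left.
by apply: (hm x); [case: hy => ->|apply/upairP; left].
Qed.

Lemma asym x y : x ε y -> ~ y ε x.
Proof.
move=> h h'; have [|z [/upairP hz hm]] := @foundation (upair x y).
  by exists x; apply/upairP; left.
by case: hz hm => -> hm; [apply: (hm y)|apply: (hm x)] => //; apply/upairP; auto.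
Qed.

Lemma sc_inj x y : sc x = sc y -> x = y.
Proof.
move=> e; have /scP[h|//] : x ε sc y by rewrite -e; apply/scP; right.
have /scP[h'|//] : y ε sc x by rewrite e; apply/scP; right.
by case: (asym h h').
Qed.

Lemma dterm_upair f g : dterm f -> dterm g -> dterm (fun rho => upair (f rho) (g rho)).
Proof.
apply: dterm_app2; apply: (dfn_ext (P := fun rho => forall w, w ε rho 0 <-> w = rho 1 \/ w = rho 2)).
  move=> rho; split=> [h|->] => [|w]; last exact: upairP.
  by apply: set_ext => w; rewrite h upairP.
solve_dfn.
Qed.
Lemma dterm_union f : dterm f -> dterm (fun rho => union (f rho)).
Proof.
apply: dterm_app1; apply: (dfn_ext (P := fun rho => forall w, w ε rho 0 <->
  exists y, y ε rho 1 /\ w ε y)).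
  move=> rho; split=> [h|->] => [|w]; last exact: unionP.
  by apply: set_ext => w; rewrite h unionP.
solve_dfn.
Qed.

Definition adj x z := union (upair x (upair z z)).

Lemma adjP x z w : w ε adj x z <-> w ε x \/ w = z.
Proof.
rewrite unionP; split.
  by move=> [y [/upairP[->|->]]]; [left|move=> /upairP[]; right].
by move=> [h|->]; [exists x|exists (upair z z)]; rewrite !upairP; auto.
Qed.

Lemma dterm_adj f g : dterm f -> dterm g -> dterm (fun rho => adj (f rho) (g rho)).
Proof.
by move=> hf hg; apply: dterm_union; apply: dterm_upair => //; apply: dterm_upair.
Qed.

Lemma dterm_sc f : dterm f -> dterm (fun rho => sc (f rho)).
Proof. by move=> hf; apply: dterm_adj. Qed.

Lemma dterm_op f g : dterm f -> dterm g -> dterm (fun rho => op (f rho) (g rho)).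
Proof. by move=> hf hg; apply: dterm_upair; apply: dterm_upair. Qed.

End Sets.

Ltac dfn_sets := first
  [ simple apply dterm_upair | simple apply dterm_union | simple apply dterm_op
  | simple apply dterm_sc | simple apply dterm_adj ].
Ltac dfn_user ::= dfn_sets.

(** * Natural numbers and parity in the model *)

Section Numbers.

Variable M : zfModel.
Local Notation "x 'ε' y" := (@elt M x y) (at level 70).
Implicit Types (a b c u v w x y z : M).

Definition Ind w := @emp M ε w /\ forall x, x ε w -> sc x ε w.
Definition Nat x := forall w, Ind w -> x ε w.

Lemma dfn_Nat f : dterm f -> dfn (fun rho => Nat (f rho)).
Proof. by apply: (dfn_app1 (Q := Nat)); rewrite /Nat /Ind; solve_dfn. Qed.

Lemma sat_Empty rho (x : nat) : sat (@elt M) rho (fEmpty x) <-> rho x = @emp M.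
Proof.
split=> [/sat_all h|e]; first by apply: emp_eq => z; exact: (h z).
by apply/sat_all => z /=; rewrite e; apply: empP.
Qed.

Lemma sat_Succ rho (y x : nat) : sat (@elt M) rho (fSucc y x) <-> rho y = sc (rho x).
Proof.
split=> [/sat_all h|e].
  apply: set_ext => z; rewrite scP; have /sat_iff h1 := h z.
  by apply: iff_trans h1 _; rewrite sat_or.
by apply/sat_all => z; apply/sat_iff; rewrite sat_or /= e; apply: scP.
Qed.

Lemma sat_Inductive rho (w : nat) : sat (@elt M) rho (fInductive w) <-> Ind (rho w).
Proof.
rewrite /fInductive sat_and !sat_ex; split.
  move=> [[x hx] hS]; have /sat_and[/sat_Empty /= e h0] := hx; split; first by rewrite -e.
  move=> y hy; have /sat_all/(_ y)/sat_imp/(_ hy)/sat_ex[z hz] := hS.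
  by have /sat_and[/sat_Succ /= <-] := hz.
move=> [h0 hS]; split; first by exists (@emp M); apply/sat_and; split=> //; apply/sat_Empty.
apply/sat_all => x; apply/sat_imp => hx; apply/sat_ex; exists (sc x).
by apply/sat_and; split; [apply/sat_Succ|apply: hS].
Qed.

Lemma sat_Nat rho (x : nat) : sat (@elt M) rho (fNat x) <-> Nat (rho x).
Proof.
split=> [/sat_all h w hw|h].
  by have /sat_imp := h w; apply; apply/sat_Inductive.
by apply/sat_all => w; apply/sat_imp => /sat_Inductive; apply: h.
Qed.

Lemma Nat_emp : Nat (@emp M).
Proof. by move=> w []. Qed.

Lemma Nat_sc x : Nat x -> Nat (sc x).
Proof. by move=> h w hw; apply: (proj2 hw); apply: h. Qed.

Definition omega : M := the (fun w => forall x, x ε w <-> Nat x).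

Lemma omegaP x : x ε omega <-> Nat x.
Proof.
apply: (theP (P := fun w => forall x, x ε w <-> Nat x)).
have /sat_ex[w /sat_Inductive hw] := zf_axioms ZFC_inf (fun=> x).
have [|b hb] := separation (P := Nat) w; first by apply: dfn_Nat; solve_dfn.
by exists b => y; rewrite hb; split=> [[]//|hy]; split=> //; apply: hy.
Qed.

(** Separation turns [P] into an inductive set. The model may have nonstandard numbers, which is why
    [P] has to be definable. *)
Lemma nat_ind (P : M -> Prop) : dfn (fun rho => P (rho 0)) ->
  P (@emp M) -> (forall x, Nat x -> P x -> P (sc x)) -> forall x, Nat x -> P x.
Proof.
move=> hP h0 hS x hx; have [b hb] := separation omega hP.
suff hi : Ind b by have /hb[] := hx b hi.
split; first by apply/hb; split=> //; apply/omegaP/Nat_emp.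
move=> y /hb[/omegaP hy h]; apply/hb; split; first exact/omegaP/Nat_sc.
exact: hS.
Qed.

Ltac dfn_user ::= first [ dfn_sets | simple apply dfn_Nat ].

Ltac nat_induction x :=
  move: x; match goal with |- forall x, Nat x -> @?P x =>
    refine (nat_ind (P := P) _ _ _); [solve_dfn|cbv beta|cbv beta] end.


Lemma nat_case x : Nat x -> x = @emp M \/ exists y, Nat y /\ x = sc y.
Proof.
by nat_induction x; [left|move=> y hy _; right; exists y].
Qed.

Lemma nat_mem x y : Nat x -> y ε x -> Nat y.
Proof.
move=> hx; move: hx y; nat_induction x.
  by move=> y /empP.
by move=> x hx IH y /scP[/IH|->].
Qed.

Lemma Nat_pred x : Nat (sc x) -> Nat x.
Proof. by move=> /nat_mem; apply; apply/scP; right. Qed.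

Lemma nat_trans x y z : Nat x -> y ε x -> z ε y -> z ε x.
Proof.
move=> hx; move: hx y z; nat_induction x.
  by move=> y z /empP.
by move=> x hx IH y z /scP[hy /(IH _ _ hy)|->] h; apply/scP; left.
Qed.

Lemma emp_lt_sc x : Nat x -> @emp M ε sc x.
Proof.
nat_induction x; first by apply/scP; right.
by move=> x _ h; apply/scP; left.
Qed.

Lemma sc_le x y : Nat x -> y ε x -> sc y ε sc x.
Proof.
move=> hx; move: hx y; nat_induction x; first by move=> y /empP.
move=> x hx IH y /scP[/IH h|->]; apply/scP; [by left|by right].
Qed.

Lemma nat_tri x y : Nat x -> Nat y -> x ε y \/ x = y \/ y ε x.
Proof.
move=> hx; move: hx y; nat_induction x.
  by move=> y /nat_case[->|[z [hz ->]]]; [right; left|left; apply: emp_lt_sc].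
move=> x hx IH y hy; have [h|[h|h]] := IH y hy.
- by have /scP[] := sc_le hy h; auto.
- by right; right; rewrite h; apply/scP; right.
- by right; right; apply/scP; left.
Qed.

Lemma nat_least (P : M -> Prop) : dfn (fun rho => P (rho 0)) ->
  (exists x, Nat x /\ P x) -> exists x, Nat x /\ P x /\ forall y, y ε x -> ~ P y.
Proof.
move=> hP [x [hx px]]; have [b hb] := separation omega hP.
have [|y [/hb[/omegaP hy py] h]] := @foundation M b.
  by exists x; apply/hb; split=> //; apply/omegaP.
exists y; split=> //; split=> // z hz pz; apply: (h z hz); apply/hb; split=> //.
by apply/omegaP; apply: nat_mem hz.
Qed.

Definition Alt w x := @emp M ε w /\ forall y, y ε x -> (sc y ε w <-> ~ y ε w).
Definition Even x := Nat x /\ exists w, Alt w x /\ x ε w.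
Definition Odd x := Nat x /\ ~ Even x.

Lemma Alt_sc w x : Alt w (sc x) -> Alt w x /\ (sc x ε w <-> ~ x ε w).
Proof.
move=> [h0 h]; split; last by apply: h; apply/scP; right.
by split=> // y hy; apply: h; apply/scP; left.
Qed.

Lemma Alt_agree x w w' : Nat x -> Alt w x -> Alt w' x -> (x ε w <-> x ε w').
Proof.
move=> hx; move: hx w w'; rewrite /Alt; nat_induction x.
  by move=> w w' [h _] [h' _].
move=> x hx IH w w' /Alt_sc[h1 h2] /Alt_sc[h3 h4].
by rewrite h2 h4 (IH w w').
Qed.

Lemma Alt_exists x : Nat x -> exists w, Alt w x.
Proof.
rewrite /Alt; nat_induction x.
  by exists (upair (@emp M) (@emp M)); split; [apply/upairP; left|move=> y /empP].
move=> x hx [w0 [h0 h]].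
(* [w0] is unconstrained above [x] and may already contain [sc x]; the separation removes it again
   when [x] belongs to [w0]. *)
have [|w hw] := separation (P := fun y => y = sc x -> ~ x ε w0) (adj w0 (sc x)).
  solve_dfn.
have hw' y : y ε w <-> (y ε w0 \/ y = sc x) /\ (y = sc x -> ~ x ε w0).
  by rewrite hw adjP.
have nx : x <> sc x by move=> e; apply: (@irrefl M x); rewrite {2}e; apply/scP; right.
exists w; split.
  by apply/hw'; split; [left|move=> /esym/sc_neq_emp].
move=> y /scP[hy|->]; last by rewrite !hw'; tauto.
have n1 : sc y <> sc x by move=> /sc_inj e; apply: (@irrefl M y); rewrite {2}e.
have n2 : y <> sc x by move=> e; apply: (asym hy); rewrite e; apply/scP; right.
by have := h y hy; rewrite !hw'; tauto.
Qed.

Lemma Even_emp : Even (@emp M).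
Proof.
split; first exact: Nat_emp; have [w hw] := Alt_exists Nat_emp.
by exists w; split=> //; case: hw.
Qed.

Lemma Even_sc x : Nat x -> (Even (sc x) <-> ~ Even x).
Proof.
move=> hx; split.
  move=> [_ [w [/Alt_sc[h1 h2] /h2 h3]]] [_ [w' [h4 h5]]].
  by apply: h3; apply/(Alt_agree hx h1 h4).
move=> h; split; first exact: Nat_sc.
have [w hw] := Alt_exists (Nat_sc hx); exists w; split=> //.
by have [h1 h2] := Alt_sc hw; apply/h2 => h3; apply: h; split=> //; exists w.
Qed.

Lemma Odd_sc x : Nat x -> (Odd (sc x) <-> Even x).
Proof.
move=> hx; rewrite /Odd Even_sc //; split=> [[_ /NNPP]|h] //.
by split; [apply: Nat_sc|tauto].
Qed.

Lemma parity x : Nat x -> Even x \/ Odd x.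
Proof. by move=> hx; case: (classic (Even x)); [left|right]. Qed.

Lemma sat_Even rho (x : nat) : sat (@elt M) rho (fEven x) <-> Even (rho x).
Proof.
rewrite /fEven !sat_and sat_Nat sat_ex; apply: and_iff_compat_l; split.
  move=> [w /sat_and[/sat_ex[y /sat_and[/sat_Empty e h0]] /sat_and[/sat_all h h1]]].
  exists w; split=> //; split; first by rewrite -e.
  move=> z hz; have /sat_imp/(_ hz)/sat_ex[v /sat_and[/sat_Succ e' /sat_iff h']] := h z.
  by rewrite [sc z](esym e').
move=> [w [[h0 h] h1]]; exists w; apply/sat_and; split.
  by apply/sat_ex; exists (@emp M); apply/sat_and; split=> //; apply/sat_Empty.
apply/sat_and; split=> //; apply/sat_all => y; apply/sat_imp => hy; apply/sat_ex.
exists (sc y); apply/sat_and; split; first exact/sat_Succ.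
by apply/sat_iff; rewrite sat_not; apply: h.
Qed.

Lemma sat_Odd rho (x : nat) : sat (@elt M) rho (fOdd x) <-> Odd (rho x).
Proof. by rewrite /fOdd sat_and sat_not sat_Nat sat_Even. Qed.

Lemma dfn_Even f : dterm f -> dfn (fun rho => Even (f rho)).
Proof. by apply: (dfn_app1 (Q := Even)); rewrite /Even /Alt; solve_dfn. Qed.

Lemma dfn_Odd f : dterm f -> dfn (fun rho => Odd (f rho)).
Proof. by apply: (dfn_app1 (Q := Odd)); rewrite /Odd /Even /Alt; solve_dfn. Qed.

End Numbers.

Ltac dfn_numbers := first
  [ dfn_sets | simple apply dfn_Nat | simple apply dfn_Even | simple apply dfn_Odd
  | match goal with H : dfn (fun rho => ?R (rho 0) (rho 1)) |- dfn _ =>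
      refine (dfn_app2 (Q := R) H _ _) end ].
Ltac dfn_user ::= dfn_numbers.

(** * Functions, restrictions and finite sequences *)

Section Functions.

Variable M : zfModel.
Local Notation "x 'ε' y" := (@elt M x y) (at level 70).
Local Notation "∅" := (@emp M).
Implicit Types (a b c d f g h m n s t u v w x y z : M).

Definition Fn f d :=
  (forall z, z ε f -> exists x y, z = op x y /\ x ε d) /\
  (forall x, x ε d -> exists y, forall z, op x z ε f <-> z = y).

(** The union of all values of [f] at [x]. It is total, has an explicit membership condition and
    equals the value wherever [f] is single-valued. *)
Definition app f x := the (fun z => forall w, w ε z <-> exists y, op x y ε f /\ w ε y).

Lemma appE f x w : w ε app f x <-> exists y, op x y ε f /\ w ε y.
Proof.
apply: (theP (P := fun z => forall w, w ε z <-> exists y, op x y ε f /\ w ε y)).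
have [|b hb] := separation (P := fun w => exists y, op x y ε f /\ w ε y)
  (union (union (union f))); first solve_dfn.
exists b => v; rewrite hb; split=> [[]//|[y [h1 h2]]]; split; last by exists y.
apply/unionP; exists y; split=> //; apply/unionP; exists (upair x y).
split; last by apply/upairP; right.
by apply/unionP; exists (op x y); split=> //; apply/upairP; right.
Qed.

Lemma appP f d x : Fn f d -> x ε d -> forall y, op x y ε f <-> y = app f x.
Proof.
move=> [_ h] /h[y0 hy0] y; rewrite hy0; suff -> : app f x = y0 by [].
apply: set_ext => z; rewrite appE; split=> [[v [/hy0 -> //]]|hz].
by exists y0; split=> //; apply/hy0.
Qed.

Lemma in_Fn f d x y : Fn f d -> (op x y ε f <-> x ε d /\ y = app f x).
Proof.
move=> hf; split; last by move=> [hx /(appP hf hx)].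
move=> h; have [x' [y' [e hx']]] := proj1 hf _ h; have [e1 e2] := op_inj e.
by subst; split=> //; apply/(appP hf).
Qed.

Lemma Fn_ext f g d : Fn f d -> Fn g d -> (forall x, x ε d -> app f x = app g x) -> f = g.
Proof.
move=> hf hg h; apply: set_ext => z; split=> hz.
  have [x [y [e hx]]] := proj1 hf _ hz; subst.
  by move: hz => /(in_Fn _ _ hf)[_ ->]; apply/(in_Fn _ _ hg); rewrite h.
have [x [y [e hx]]] := proj1 hg _ hz; subst.
by move: hz => /(in_Fn _ _ hg)[_ ->]; apply/(in_Fn _ _ hf); rewrite h.
Qed.

Lemma Fn_dom f d d' : Fn f d -> Fn f d' -> d = d'.
Proof.
move=> h h'; apply: set_ext => x; split=> hx.
  by have /(in_Fn _ _ h')[] : op x (app f x) ε f by apply/(in_Fn _ _ h).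
by have /(in_Fn _ _ h)[] : op x (app f x) ε f by apply/(in_Fn _ _ h').
Qed.

Lemma Fn_emp : Fn ∅ ∅.
Proof. by split=> z /empP. Qed.

Lemma Fn_emp_eq f : Fn f ∅ -> f = ∅.
Proof. by move=> h; apply: (Fn_ext h Fn_emp) => x /empP. Qed.

Definition restr f d := the (fun s => forall z, z ε s <->
  z ε f /\ exists x y, x ε d /\ z = op x y).

Lemma restrP f d z : z ε restr f d <-> z ε f /\ exists x y, x ε d /\ z = op x y.
Proof.
apply: (theP (P := fun s => forall z, z ε s <-> z ε f /\ exists x y, x ε d /\ z = op x y)).
by apply: separation; solve_dfn.
Qed.

Lemma op_restr f d x y : op x y ε restr f d <-> op x y ε f /\ x ε d.
Proof.
rewrite restrP; split=> [[h1 [x' [y' [h2 /op_inj[e1 e2]]]]]|[h1 h2]]; first by subst.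
by split=> //; exists x, y.
Qed.

Lemma app_restr f d x : x ε d -> app (restr f d) x = app f x.
Proof.
move=> hx; apply: set_ext => z; rewrite !appE.
by split=> -[y [h1 h2]]; exists y; split=> //; [case/op_restr: h1|apply/op_restr].
Qed.

Lemma Fn_restr f d d' : Fn f d -> (forall x, x ε d' -> x ε d) -> Fn (restr f d') d'.
Proof.
move=> hf hd; split=> [z /restrP[_ [x [y [h1 h2]]]]|x hx]; first by exists x, y.
by exists (app f x) => z; rewrite op_restr (in_Fn _ _ hf); split=> [[[]]|->] //; auto.
Qed.

Lemma restr_restr f d d' : (forall x, x ε d' -> x ε d) -> restr (restr f d) d' = restr f d'.
Proof.
move=> hd; apply: set_ext => z; rewrite !restrP.
split=> [[[h1 h2] h3]|[h1 [x [y [h2 h3]]]]] //.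
by split; [split=> //; exists x, y; auto|exists x, y].
Qed.

Lemma restr_id f d : Fn f d -> restr f d = f.
Proof.
move=> h; apply: (Fn_ext (Fn_restr h (fun _ => id)) h) => x hx.
by rewrite app_restr.
Qed.

Lemma restr_congr f g d d1 d2 : Fn f d1 -> Fn g d2 ->
  (forall x, x ε d -> x ε d1 /\ x ε d2 /\ app f x = app g x) -> restr f d = restr g d.
Proof.
move=> hf hg h; apply: (Fn_ext (d := d)).
- by apply: Fn_restr hf _ => x /h[].
- by apply: Fn_restr hg _ => x /h[_[]].
- by move=> x hx; rewrite !app_restr //; have [_ []] := h x hx.
Qed.

Definition snoc f d y := adj f (op d y).

Lemma Fn_snoc f d y : Fn f d -> Fn (snoc f d y) (sc d).
Proof.
move=> hf; split.
  move=> z /adjP[hz|->]; last by exists d, y; split=> //; apply/scP; right.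
  by have [x [v [e hx]]] := proj1 hf _ hz; exists x, v; split=> //; apply/scP; left.
move=> x /scP[hx|->].
  exists (app f x) => z; rewrite adjP (in_Fn _ _ hf); split=> [[[]//|/op_inj[e _]]|->].
    by case: (@irrefl M x); rewrite {2}e.
  by left.
exists y => z; rewrite adjP (in_Fn _ _ hf); split=> [[[h _]|/op_inj[]//]|->].
  by case: (irrefl h).
by right.
Qed.

Lemma app_snoc_last f d y : Fn f d -> app (snoc f d y) d = y.
Proof.
move=> hf; symmetry; apply/(appP (Fn_snoc y hf)); first by apply/scP; right.
by apply/adjP; right.
Qed.

Lemma app_snoc f d y x : Fn f d -> x ε d -> app (snoc f d y) x = app f x.
Proof.
move=> hf hx; symmetry; apply/(appP (Fn_snoc y hf)); first by apply/scP; left.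
by apply/adjP; left; apply/(in_Fn _ _ hf).
Qed.

Lemma restr_snoc f d y d' : Fn f d -> (forall x, x ε d' -> x ε d) ->
  restr (snoc f d y) d' = restr f d'.
Proof.
move=> hf h; apply: (restr_congr (Fn_snoc y hf) hf) => x /h hx.
by split; [apply/scP; left|split=> //; apply: app_snoc].
Qed.

Lemma dterm_app (f g : (nat -> M) -> M) : dterm f -> dterm g -> dterm (fun rho => app (f rho) (g rho)).
Proof.
apply: dterm_app2; apply: (dfn_ext (P := fun rho => forall w, w ε rho 0 <->
  exists y, op (rho 2) y ε rho 1 /\ w ε y)).
  move=> rho; split=> [h|->] => [|w]; last exact: appE.
  by apply: set_ext => w; rewrite h appE.
solve_dfn.
Qed.

Lemma dterm_restr (f g : (nat -> M) -> M) : dterm f -> dterm g -> dterm (fun rho => restr (f rho) (g rho)).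
Proof.
apply: dterm_app2; apply: (dfn_ext (P := fun rho => forall z, z ε rho 0 <->
  z ε rho 1 /\ exists x y, x ε rho 2 /\ z = op x y)).
  move=> rho; split=> [h|->] => [|w]; last exact: restrP.
  by apply: set_ext => w; rewrite h restrP.
solve_dfn.
Qed.

Lemma dfn_Fn (f g : (nat -> M) -> M) : dterm f -> dterm g -> dfn (fun rho => Fn (f rho) (g rho)).
Proof. by apply: (dfn_app2 (Q := Fn)); rewrite /Fn; solve_dfn. Qed.

End Functions.

Ltac dfn_user ::= first
  [ dfn_numbers | simple apply dterm_app | simple apply dterm_restr | simple apply dfn_Fn ].

(** * Recursion along the natural numbers of the model *)

Section Recursion.

Variable M : zfModel.
Local Notation "x 'ε' y" := (@elt M x y) (at level 70).
Local Notation "∅" := (@emp M).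
Implicit Types (a b c d f g h m n s t u v w x y z : M).

Lemma abstraction (R : M -> M -> Prop) d : dfn (fun rho => R (rho 0) (rho 1)) ->
  (forall x, x ε d -> exists! y, R x y) -> exists f, Fn f d /\ forall x, x ε d -> R x (app f x).
Proof.
move=> hR h.
have [||f hf] := replacement (R := fun x z => exists y, z = op x y /\ R x y) (a := d).
- solve_dfn.
- move=> x z z' /h[y0 [_ hy0]] [y [-> /hy0 <-]] [y' [-> /hy0 <-]] //.
have hf' x y : op x y ε f <-> x ε d /\ R x y.
  rewrite hf; split=> [[x' [hx' [y' [/op_inj[-> ->]]]]]|[hx hy]] //.
  by exists x; split=> //; exists y.
have hF : Fn f d.
  split=> [z /hf[x [hx [y [-> _]]]]|x hx]; first by exists x, y.
  have [y [hy hu]] := h x hx; exists y => z; rewrite hf'.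
  by split=> [[_ /hu]|->].
exists f; split=> // x hx.
by have /hf'[] : op x (app f x) ε f by apply/(in_Fn _ _ hF).
Qed.

Section RecursionTheorem.

Variable R : M -> M -> Prop.
Hypothesis dfnR : dfn (fun rho => R (rho 0) (rho 1)).
Hypothesis totR : forall s n, Nat n -> Fn s n -> exists y, R s y.
Hypothesis funR : forall s n y y', Nat n -> Fn s n -> R s y -> R s y' -> y = y'.

Let Ap n f := Fn f n /\ forall m, m ε n -> R (restr f m) (app f m).

Lemma Ap_restr n m f : Nat n -> (forall k, k ε m -> k ε n) -> Nat m -> Ap n f -> Ap m (restr f m).
Proof.
move=> hn hmn hm [hf h]; split; first exact: Fn_restr hf hmn.
move=> k hk; rewrite app_restr // restr_restr; first by apply: h; apply: hmn.
by move=> x; apply: nat_trans hm hk.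
Qed.

Lemma sub_sc x y : x ε y -> x ε sc y.
Proof. by move=> h; apply/scP; left. Qed.

Lemma Ap_exists n : Nat n -> (exists f, Ap n f) /\ (forall f g, Ap n f -> Ap n g -> f = g).
Proof.
move: n; apply: (nat_ind (P := fun n => (exists f, Ap n f) /\
  forall f g, Ap n f -> Ap n g -> f = g)); first by rewrite /Ap; solve_dfn.
  split; first by exists ∅; split; [apply: Fn_emp|move=> m /empP].
  by move=> f g [/Fn_emp_eq -> _] [/Fn_emp_eq -> _].
move=> n hn [[f [hf h]] hu]; split.
  have [y hy] := totR hn hf; exists (snoc f n y); split; first exact: Fn_snoc.
  move=> m /scP[hm|->].
    rewrite app_snoc // restr_snoc //; first exact: h.
    by move=> x; apply: nat_trans hn hm.
  by rewrite app_snoc_last // restr_snoc // restr_id.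
move=> f1 f2 h1 h2.
have hS := Nat_sc hn.
have e : restr f1 n = restr f2 n.
  by apply: hu; apply: (Ap_restr hS (fun x => @sub_sc x n) hn).
apply: (Fn_ext (proj1 h1) (proj1 h2)) => x /scP[hx|->].
  by rewrite -(app_restr f1 hx) e app_restr.
have i : n ε sc n by apply/scP; right.
apply: (funR hn (Fn_restr (proj1 h1) (fun x => @sub_sc x n))); first exact: (proj2 h1).
by rewrite e; apply: (proj2 h2).
Qed.

(** Course-of-values recursion for a definable class relation. There is exactly one approximation of
    each length, so replacement collects them; uniqueness also makes them agree where they overlap,
    and their union is the function. *)
Lemma recursion : exists f, Fn f (omega M) /\ forall n, Nat n -> R (restr f n) (app f n).
Proof.
have [||F hF] := replacement (R := Ap) (a := omega M).
- by rewrite /Ap; solve_dfn.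
- by move=> n f g /omegaP hn; apply: (proj2 (Ap_exists hn)).
have cut n f : Nat n -> Ap n f -> forall m g, m ε n -> Ap (sc m) g -> app f m = app g m.
  move=> hn hf m g hm hg; have hm' := nat_mem hn hm.
  suff <- : restr f (sc m) = g by rewrite app_restr //; apply/scP; right.
  apply: (proj2 (Ap_exists (Nat_sc hm'))) => //; apply: (Ap_restr hn _ (Nat_sc hm') hf).
  by move=> k /scP[|->] //; apply: nat_trans hn hm.
have hU z : z ε union F <-> exists n f, Nat n /\ Ap n f /\ z ε f.
  rewrite unionP; split=> [[f [/hF[n [/omegaP hn h1]] h2]]|[n [f [hn [h1 h2]]]]].
    by exists n, f.
  by exists f; split=> //; apply/hF; exists n; split=> //; apply/omegaP.
have hfun : Fn (union F) (omega M).
  split.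
    move=> z /hU[n [f [hn [[hf _] hz]]]]; have [x [y [e hx]]] := proj1 hf _ hz.
    by exists x, y; split=> //; apply/omegaP; apply: nat_mem hx.
  move=> m /omegaP hm; have [f hf] := proj1 (Ap_exists (Nat_sc hm)).
  have i : m ε sc m by apply/scP; right.
  exists (app f m) => z; rewrite hU; split.
    move=> [n [g [hn [hg /(in_Fn _ _ (proj1 hg))[h ->]]]]].
    exact: cut hg _ _ h hf.
  move=> ->; exists (sc m), f; split; first exact: Nat_sc.
  by split=> //; apply/(in_Fn _ _ (proj1 hf)).
exists (union F); split=> // n hn.
have happ k g : Nat k -> Ap k g -> forall m, m ε k -> app (union F) m = app g m.
  move=> hk hg m hm; symmetry; apply/(appP hfun); first by apply/omegaP; apply: nat_mem hm.
  by apply/hU; exists k, g; split=> //; split=> //; apply/(in_Fn _ _ (proj1 hg)).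
have [f hf] := proj1 (Ap_exists (Nat_sc hn)).
have i : n ε sc n by apply/scP; right.
rewrite (happ _ _ (Nat_sc hn) hf _ i).
suff -> : restr (union F) n = restr f n by apply: (proj2 hf).
apply: (restr_congr hfun (proj1 hf)) => x hx; have hx' := sub_sc hx.
split; first by apply/omegaP; apply: nat_mem hx.
by split=> //; apply: happ hf _ hx'; apply: Nat_sc.
Qed.

End RecursionTheorem.

(** * Meaning of the formulas for pairs, functions and plays *)

Lemma sat_UPair rho (z x y : nat) :
  sat (@elt M) rho (fUPair z x y) <-> rho z = upair (rho x) (rho y).
Proof.
split=> [/sat_all h|e].
  apply: set_ext => w; rewrite upairP; have /sat_iff h1 := h w.
  by apply: iff_trans h1 _; rewrite sat_or.
by apply/sat_all => w; apply/sat_iff; rewrite sat_or /= e; apply: upairP.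
Qed.

Lemma sat_Pair rho (z x y : nat) :
  sat (@elt M) rho (fPair z x y) <-> rho z = op (rho x) (rho y).
Proof.
rewrite /fPair sat_ex; split.
  move=> [u /sat_ex[v /sat_and[/sat_UPair e1 /sat_and[/sat_UPair e2 /sat_UPair e3]]]].
  by move: e1 e2 e3 => /= -> -> ->.
move=> e; exists (upair (rho x) (rho x)); apply/sat_ex; exists (upair (rho x) (rho y)).
by rewrite !sat_and !sat_UPair.
Qed.

Lemma sat_PairIn rho (x y f : nat) :
  sat (@elt M) rho (fPairIn x y f) <-> op (rho x) (rho y) ε rho f.
Proof.
rewrite /fPairIn sat_ex; split=> [[z /sat_and[/sat_Pair /= <-]]|h] //.
by exists (op (rho x) (rho y)); rewrite sat_and sat_Pair.
Qed.

Lemma sat_Omega rho (w : nat) : sat (@elt M) rho (fOmega w) <-> rho w = omega M.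
Proof.
split=> [/sat_all h|e].
  apply: set_ext => x; rewrite omegaP; have /sat_iff h1 := h x.
  by apply: iff_trans h1 _; rewrite sat_Nat.
by apply/sat_all => x; apply/sat_iff; rewrite sat_Nat /= e; apply: omegaP.
Qed.

Lemma sat_Restr rho (s a n : nat) :
  sat (@elt M) rho (fRestr s a n) <-> rho s = restr (rho a) (rho n).
Proof.
have e z : sat (@elt M) (scons z rho) (∃ ∃ 1 ∈ n.+3 ∧ fPair 2 1 0) <->
   exists x y, x ε rho n /\ z = op x y.
  rewrite sat_ex; split=> [[x /sat_ex[y /sat_and[h /sat_Pair h']]]|[x [y [h h']]]].
    by exists x, y.
  by exists x; apply/sat_ex; exists y; apply/sat_and; split=> //; apply/sat_Pair.
split=> [/sat_all h|es].
  apply: set_ext => z; rewrite restrP; have /sat_iff h1 := h z.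
  by apply: iff_trans h1 _; rewrite sat_and e.
by apply/sat_all => z; apply/sat_iff; rewrite sat_and e /= es; apply: restrP.
Qed.

Definition univ := (0 ≡ 0)%F.

Lemma sat_Fun rho (f d : nat) : sat (@elt M) rho (fFun univ f d) <-> Fn (rho f) (rho d).
Proof.
rewrite /fFun sat_and; split.
  move=> [/sat_all h1 /sat_all h2]; split.
    move=> z hz; have /sat_imp/(_ hz)/sat_ex[x /sat_ex[y]] := h1 z.
    by move=> /sat_and[/sat_Pair e /sat_and[hx _]]; exists x, y.
  move=> x hx; have /sat_imp/(_ hx)/sat_ex[y /sat_all hy] := h2 x.
  by exists y => z; have /sat_iff := hy z; rewrite sat_PairIn.
move=> [h1 h2]; split; apply/sat_all => z; apply/sat_imp => hz.
  have [x [y [e hx]]] := h1 z hz; apply/sat_ex; exists x; apply/sat_ex; exists y.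
  by rewrite !sat_and sat_Pair.
have [y hy] := h2 z hz; apply/sat_ex; exists y; apply/sat_all => x; apply/sat_iff.
by rewrite sat_PairIn; apply: hy.
Qed.

Lemma sat_Play rho (a : nat) : sat (@elt M) rho (fPlay univ a) <-> Fn (rho a) (omega M).
Proof.
rewrite /fPlay sat_ex; split=> [[w /sat_and[/sat_Omega e /sat_Fun]]|h].
  by rewrite e.
by exists (omega M); apply/sat_and; split; [apply/sat_Omega|apply/sat_Fun].
Qed.

Lemma sat_Position rho (s : nat) :
  sat (@elt M) rho (fPosition univ s) <-> exists n, Nat n /\ Fn (rho s) n.
Proof.
rewrite /fPosition sat_ex; split=> [[n /sat_and[/sat_Nat hn /sat_Fun hs]]|[n [hn hs]]].
  by exists n.
by exists n; apply/sat_and; split; [apply/sat_Nat|apply/sat_Fun].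
Qed.

End Recursion.

(** * The game *)

(* a_m = ((v, C), x): the code (v, C) is played, and its name v gets the value x. *)
Definition fAt a m v C x :=
  ∃ ∃ fPair 1 v.+2 C.+2 ∧ fPair 0 1 x.+2 ∧ fPairIn m.+2 0 a.+2.
Definition fHas a n i x := ∃ ∃ 1 ∈ n.+2 ∧ fAt a.+2 1 i.+2 0 x.+2.
Definition fTest a n i j :=
  ∃ ∃ fHas a.+2 n.+2 i.+2 1 ∧ fHas a.+2 n.+2 j.+2 0 ∧ 1 ∈ 0.
Definition fCur a n C :=
  ∃ ∃ ∃ fSucc n.+3 2 ∧
    (fAt a.+3 2 1 C.+3 0 ∨ ∃ fEmpty 0 ∧ fPairIn 3 0 a.+4 ∧ fAt a.+4 0 2 C.+4 1).
Definition fNormal a n :=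
  ∃ ∃ ∃ ∃ fCur a.+4 n.+4 3 ∧ fAt a.+4 n.+4 2 1 0 ∧
    (∃ fPair 0 3 2 ∧ 0 ∈ 4) ∧
    (fEmpty 1 → ∀ ∀ fPair 4 1 0 → fTest (6 + a) (6 + n) 1 0).
Definition fLegal a n :=
  fEmpty n ∨ (∃ fEmpty 0 ∧ fSucc n.+1 0 ∧ fPairIn n.+1 0 a.+1) ∨ fNormal a n.
Definition fWinI :=
  fPlay univ 0 ∧ ∃ fOdd 0 ∧ ¬ fLegal 1 0 ∧ (∀ 0 ∈ 1 → fLegal 2 0).

Section Game.

Variable M : zfModel.
Local Notation "x 'ε' y" := (@elt M x y) (at level 70).
Local Notation "∅" := (@emp M).
Implicit Types (a b c d h i j k m n s t u v w x y z C D U : M).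

Definition mv v C x := op (op v C) x.
Definition Has a n i x := exists m C, m ε n /\ app a m = mv i C x.
Definition Test a n i j := exists x y, Has a n i x /\ Has a n j y /\ x ε y.
(* C is the set of children of the code from which the move n is made; the move ∅
   at stage 1 is the pass of player II, which leaves the first code in force. *)
Definition Cur a n C := exists m v x, n = sc m /\
  (app a m = mv v C x \/ (app a m = ∅ /\ app a ∅ = mv v C x)).
Definition Normal a n := exists C v D x, Cur a n C /\ app a n = mv v D x /\
  op v D ε C /\ (D = ∅ -> forall i j, v = op i j -> Test a n i j).
(** The first move is unrestricted. If it is not of the form [mv v C x], then no code is ever put in
    force: player II can pass, and player I has no legal move at stage 2. *)
Definition Legal a n := n = ∅ \/ (n = sc ∅ /\ app a n = ∅) \/ Normal a n.
Definition Lost a n := Nat n /\ ~ Legal a n /\ forall m, m ε n -> Legal a m.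
Definition WinI a := Fn a (omega M) /\ exists n, Odd n /\ Lost a n.

Lemma mv_inj v C x v' C' x' : mv v C x = mv v' C' x' -> [/\ v = v', C = C' & x = x'].
Proof. by move=> /op_inj[/op_inj[-> ->] ->]. Qed.

Lemma mv_neq_emp v C x : mv v C x <> ∅.
Proof. exact: op_neq_emp. Qed.

Section Formulas.

Variable rho : nat -> M.

Lemma sat_At (a m v C x : nat) : Fn (rho a) (omega M) -> Nat (rho m) ->
  sat (@elt M) rho (fAt a m v C x) <-> app (rho a) (rho m) = mv (rho v) (rho C) (rho x).
Proof.
move=> ha hm; rewrite /fAt sat_ex; split.
  move=> [c /sat_ex[z /sat_and[/sat_Pair e1 /sat_and[/sat_Pair e2 /sat_PairIn e3]]]].
  by move: e1 e2 e3 => /= -> -> /(in_Fn _ _ ha)[_ <-].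
move=> e; exists (op (rho v) (rho C)); apply/sat_ex; exists (mv (rho v) (rho C) (rho x)).
rewrite !sat_and !sat_Pair sat_PairIn; split=> //; split=> //=.
by apply/(in_Fn _ _ ha); split=> //; apply/omegaP.
Qed.

End Formulas.

Lemma sat_Has rho (a n i x : nat) : Fn (rho a) (omega M) -> Nat (rho n) ->
  sat (@elt M) rho (fHas a n i x) <-> Has (rho a) (rho n) (rho i) (rho x).
Proof.
move=> ha hn; rewrite /fHas sat_ex.
split=> [[m /sat_ex[C /sat_and[hm h]]]|[m [C [hm h]]]].
  by exists m, C; split=> //; move: h; rewrite sat_At //; apply: nat_mem hm.
exists m; apply/sat_ex; exists C; rewrite sat_and sat_At //; exact: nat_mem hm.
Qed.

Lemma sat_Test rho (a n i j : nat) : Fn (rho a) (omega M) -> Nat (rho n) ->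
  sat (@elt M) rho (fTest a n i j) <-> Test (rho a) (rho n) (rho i) (rho j).
Proof.
move=> ha hn; rewrite /fTest sat_ex; split.
  by move=> [x /sat_ex[y]]; rewrite !sat_and !sat_Has // => h; exists x, y.
by move=> [x [y h]]; exists x; apply/sat_ex; exists y; rewrite !sat_and !sat_Has.
Qed.

Lemma sat_Cur rho (a n C : nat) : Fn (rho a) (omega M) -> Nat (rho n) ->
  sat (@elt M) rho (fCur a n C) <-> Cur (rho a) (rho n) (rho C).
Proof.
move=> ha hn; rewrite /fCur sat_ex; split.
  move=> [m /sat_ex[v /sat_ex[x]]]; rewrite sat_and sat_Succ sat_or sat_ex => -[e h].
  have hm : Nat m by apply: Nat_pred; rewrite -e.
  exists m, v, x; split=> //; move: h; rewrite sat_At // => -[h|[z]]; first by left.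
  rewrite !sat_and sat_Empty sat_PairIn (in_Fn _ _ ha) => -[ez [[_ em]]].
  by rewrite sat_At //; [move: ez em => /= -> <-; right|rewrite [Nat _]/(Nat z) [z]ez; apply: Nat_emp].
move=> [m [v [x [e h]]]]; have hm : Nat m by apply: Nat_pred; rewrite -e.
exists m; apply/sat_ex; exists v; apply/sat_ex; exists x.
rewrite sat_and sat_Succ sat_or sat_ex; split=> //; rewrite sat_At //.
case: h => [h|[h1 h2]]; [by left|right; exists ∅].
rewrite !sat_and sat_Empty sat_PairIn (in_Fn _ _ ha) sat_At //=; last exact: Nat_emp.
by split=> //; split=> //; split; [apply/omegaP|].
Qed.

Lemma sat_Normal rho (a n : nat) : Fn (rho a) (omega M) -> Nat (rho n) ->
  sat (@elt M) rho (fNormal a n) <-> Normal (rho a) (rho n).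
Proof.
move=> ha hn; rewrite /fNormal sat_ex.
have e C v D x : sat (@elt M) (x .: (D .: (v .: (C .: rho))))
  (fCur a.+4 n.+4 3 ∧ fAt a.+4 n.+4 2 1 0 ∧
    (∃ fPair 0 3 2 ∧ 0 ∈ 4) ∧
    (fEmpty 1 → ∀ ∀ fPair 4 1 0 → fTest (6 + a) (6 + n) 1 0)) <->
  Cur (rho a) (rho n) C /\ app (rho a) (rho n) = mv v D x /\
  op v D ε C /\ (D = ∅ -> forall i j, v = op i j -> Test (rho a) (rho n) i j).
  rewrite 3!sat_and sat_Cur // sat_At // sat_ex sat_imp sat_Empty sat_all.
  apply: and_iff_compat_l; apply: and_iff_compat_l.
  have -> : (exists x0, sat (@elt M) (x0 .: (x .: (D .: (v .: (C .: rho)))))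
              (fPair 0 3 2 ∧ 0 ∈ 4)) <-> op v D ε C.
    split=> [[z /sat_and[/sat_Pair /= ->]]|h] //.
    by exists (op v D); rewrite sat_and sat_Pair.
  apply: and_iff_compat_l; split=> h e.
    move=> i j ev; have /sat_all/(_ j)/sat_imp := h e i.
    by rewrite sat_Pair sat_Test // => /(_ ev).
  move=> i; apply/sat_all => j; apply/sat_imp; rewrite sat_Pair sat_Test //.
  exact: h.
split.
  by move=> [C /sat_ex[v /sat_ex[D /sat_ex[x /e h]]]]; exists C, v, D, x.
move=> [C [v [D [x /e h]]]]; exists C; apply/sat_ex; exists v.
by apply/sat_ex; exists D; apply/sat_ex; exists x.
Qed.

Lemma sat_Legal rho (a n : nat) : Fn (rho a) (omega M) -> Nat (rho n) ->
  sat (@elt M) rho (fLegal a n) <-> Legal (rho a) (rho n).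
Proof.
move=> ha hn; rewrite /fLegal !sat_or sat_Empty sat_Normal // sat_ex.
apply: or_iff_compat_l; apply: or_iff_compat_r; split.
  move=> [z]; rewrite !sat_and sat_Empty sat_Succ sat_PairIn /= => -[-> [->]].
  by move=> /(in_Fn _ _ ha)[_ <-].
move=> [e h]; exists ∅; rewrite !sat_and sat_Empty sat_Succ sat_PairIn /=.
by split=> //; split=> //; apply/(in_Fn _ _ ha); split=> //; apply/omegaP.
Qed.

Lemma sat_WinI rho : sat (@elt M) rho fWinI <-> WinI (rho 0).
Proof.
rewrite /fWinI sat_and sat_Play; split=> -[ha]; rewrite ?sat_ex => hn; split=> //.
  move: hn => [n]; rewrite sat_and sat_Odd sat_and sat_not sat_all => -[ho [hl h]].
  exists n; split=> //; have hn : Nat n by case: ho.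
  split=> //; split=> [|m hm]; first by move: hl; rewrite sat_Legal.
  by have := h m; rewrite sat_imp sat_Legal //=; [apply|apply: nat_mem hm].
move: hn => [n [ho [hn [hl h]]]]; exists n.
rewrite sat_and sat_Odd sat_and sat_not sat_all sat_Legal //; split=> //; split=> // m.
by rewrite sat_imp => hm; rewrite sat_Legal //=; [apply: h|apply: nat_mem hm].
Qed.

Lemma Has_congr a b n i x : (forall m, m ε n -> app a m = app b m) ->
  Has a n i x -> Has b n i x.
Proof. by move=> h [m [C [hm e]]]; exists m, C; rewrite -h. Qed.

Lemma Normal_congr a b n : Nat n -> (forall m, m ε sc n -> app a m = app b m) ->
  Normal a n -> Normal b n.
Proof.
move=> hn h [C [v [D [x [[m [w [z [e hC]]]] [h1 [h2 h3]]]]]]].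
have hm : Nat m by apply: Nat_pred; rewrite -e.
have i0 : ∅ ε sc n by apply: emp_lt_sc.
have im : m ε sc n by rewrite e; apply/scP; left; apply/scP; right.
exists C, v, D, x; split; first by exists m, w, z; rewrite -(h m) // -(h ∅).
rewrite -(h n); last by apply/scP; right.
split=> //; split=> // eD i j ev; have [u [u' [hu [hu' hh]]]] := h3 eD i j ev.
by exists u, u'; split; [|split=> //]; apply: (Has_congr (a := a)) => // l hl;
  apply: h; apply/scP; left.
Qed.

Lemma Legal_congr a b n : Nat n -> (forall m, m ε sc n -> app a m = app b m) ->
  Legal a n -> Legal b n.
Proof.
move=> hn h [->|[[e1 e2]|h1]]; [by left|right; left|right; right].
  by split=> //; rewrite -h //; apply/scP; right.
exact: Normal_congr h1.
Qed.

Lemma Lost_unique a n n' : Lost a n -> Lost a n' -> n = n'.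
Proof.
move=> [hn [h1 h2]] [hn' [h1' h2']].
by have [/h2'|[|/h2]] := nat_tri hn hn'.
Qed.

(** Legality at a stage depends on the moves up to that stage only, so the initial segment through
    the first illegal move decides the play. This gives openness for both players. *)
Lemma Lost_congr a b n : (forall m, m ε sc n -> app a m = app b m) -> Lost a n -> Lost b n.
Proof.
move=> h [hn [h1 h2]]; split=> //; split.
  by move=> h3; apply: h1; apply: Legal_congr h3 => // m hm; rewrite h.
move=> m hm; apply: Legal_congr (h2 m hm); first exact: nat_mem hm.
by move=> k /scP[hk|->]; apply: h; apply/scP; left => //; apply: nat_trans hk.
Qed.

End Game.

(** * Every play is decided at a finite stage *)

Section Clopen.

Variable M : zfModel.
Local Notation "x 'ε' y" := (@elt M x y) (at level 70).
Local Notation "∅" := (@emp M).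
Implicit Types (a b c d h i j k m n s t u v w x y z C D U : M).

Lemma dfn_Legal (f g : (nat -> M) -> M) : dterm f -> dterm g ->
  dfn (fun rho => Legal (f rho) (g rho)).
Proof.
apply: (dfn_app2 (Q := @Legal M)).
by rewrite /Legal /Normal /Cur /Test /Has /mv; solve_dfn.
Qed.

(** The stages after the free first move and the possible pass, where only normal moves are
    legal. *)
Definition Big n := Nat n /\ n <> ∅ /\ n <> sc ∅.

Lemma Big_sc n : Nat n -> n <> ∅ -> Big (sc n).
Proof.
by move=> hn h0; split; [apply: Nat_sc|split; [apply: sc_neq_emp|move=> /sc_inj]].
Qed.

Lemma Legal_Big a n : Big n -> Legal a n -> Normal a n.
Proof. by move=> [_ [h0 h1]] [|[[]|]]. Qed.

(* The codes of the moves of an endless play would violate foundation; since a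
   code op v D is two membership steps above D, the descending sequence has to
   be completed by the intermediate sets upair v D and D. *)
Lemma Lost_exists a : exists n, Lost a n.
Proof.
apply: NNPP => hn.
have legal n : Nat n -> Legal a n.
  move=> hn1; apply: NNPP => hl; apply: hn.
  have [||m [hm [h1 h2]]] := nat_least (P := fun n => ~ Legal a n).
  - by apply: dfn_not; apply: dfn_Legal; solve_dfn.
  - by exists n.
  exists m; split=> //; split=> // k hk; apply: NNPP; exact: h2.
have step n v C x : Big n -> app a n = mv v C x ->
    exists w D y, Big (sc n) /\ app a (sc n) = mv w D y /\ op w D ε C.
  move=> hB e; have hB' : Big (sc n) by case: hB => h1 [h2 _]; apply: Big_sc.
  have [|C' [w [D [y [[m [v' [x' [/sc_inj <- h]]]] [h1 [h2 _]]]]]]] := @Legal_Big a _ hB'.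
    by case: hB' => h3 _; apply: legal.
  exists w, D, y; split=> //; split=> //; case: h; rewrite e.
    by move=> /mv_inj[_ -> _].
  by move=> [/mv_neq_emp].
pose P z := exists n v C x, Big n /\ app a n = mv v C x /\ (z = op v C \/ z = upair v C \/ z = C).
have hB1 : Big (sc (sc ∅)) by apply: Big_sc; [apply/Nat_sc/Nat_emp|apply: sc_neq_emp].
have [_ [v0 [C0 [x0 [_ [e0 _]]]]]] :
    Normal a (sc (sc ∅)) by apply: Legal_Big => //; apply: legal; case: hB1.
have [||W hW] := replacement (R := fun n z => z = app a n) (a := omega M).
- solve_dfn.
- by move=> x y y' _ -> ->.
have inW n : Nat n -> app a n ε W by move=> h; apply/hW; exists n; split=> //; apply/omegaP.
pose V := union (union W).
have inV n v C x : Nat n -> app a n = mv v C x -> op v C ε V.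
  move=> h e; apply/unionP; exists (upair (op v C) (op v C)); split; last by apply/upairP; left.
  apply/unionP; exists (app a n); split; first exact: inW.
  by rewrite e; apply/upairP; left.
(* The codes lie in [V], the sets [upair v C] in its union and the sets [C] one union further. Hence
   [P] is bounded by a set, to which foundation applies. *)
have [|Z hZ] := separation (P := P) (union (upair V (union (upair (union V) (union (union V)))))).
  by rewrite /P /Big /mv; solve_dfn.
have inZ z : P z -> z ε Z.
  move=> hP; apply/hZ; split=> //; have [n [v [C [x [[h _] [/(inV _ _ _ _ h) e hz]]]]]] := hP.
  have eU : upair v C ε union V.
    by apply/unionP; exists (op v C); split=> //; apply/upairP; right.
  apply/unionP; case: hz => [->|[->|->]].
  - by exists V; split=> //; apply/upairP; left.
  - exists (union (upair (union V) (union (union V)))); split; first by apply/upairP; right.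
    by apply/unionP; exists (union V); split=> //; apply/upairP; left.
  exists (union (upair (union V) (union (union V)))); split; first by apply/upairP; right.
  apply/unionP; exists (union (union V)); split; first by apply/upairP; right.
  by apply/unionP; exists (upair v C); split=> //; apply/upairP; right.
have [|z [/hZ[_ [n [v [C [x [hB [e hz]]]]]]] hm]] := @foundation M Z.
  by exists C0; apply: inZ; exists (sc (sc ∅)), v0, C0, x0; auto.
case: hz hm => [->|[->|->]] hm.
- apply: (hm (upair v C)); first by apply/upairP; right.
  by apply: inZ; exists n, v, C, x; auto.
- apply: (hm C); first by apply/upairP; right.
  by apply: inZ; exists n, v, C, x; auto 6.
have [w [D [y [hB' [e' h]]]]] := step _ _ _ _ hB e.
apply: (hm _ h); apply: inZ; exists (sc n), w, D, y; auto.
Qed.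

Lemma sat_Sub rho (x y : nat) :
  sat (@elt M) rho (fSub x y) <-> forall z, z ε rho x -> z ε rho y.
Proof. by []. Qed.

Lemma sat_Open rho W :
  (forall a, Fn a (omega M) -> sat (@elt M) (fun=> a) W ->
     exists n, Nat n /\ forall b, Fn b (omega M) ->
       (forall m, m ε n -> app a m = app b m) -> sat (@elt M) (fun=> b) W) ->
  sat (@elt M) rho (fOpen univ W).
Proof.
move=> h; rewrite /fOpen sat_all => a; rewrite sat_imp sat_and sat_Play sat_app1.
move=> -[ha hW]; have [n [hn hb]] := h a ha hW; rewrite sat_ex; exists n.
rewrite sat_and sat_Nat sat_ex; split=> //; exists (restr a n).
rewrite sat_and sat_Restr; split=> //; rewrite sat_all => b.
rewrite sat_imp sat_and sat_Play sat_Sub sat_app1 => -[hF hs].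
apply: hb => // m hm; symmetry.
have hm' : m ε omega M by apply/omegaP; apply: nat_mem hm.
have : op m (app a m) ε b.
  by apply: hs; apply/op_restr; split=> //; apply/(in_Fn _ _ ha).
by move=> /(in_Fn _ _ hF)[_ ->].
Qed.

Lemma clopen rho : sat (@elt M) rho (fClopen univ fWinI).
Proof.
rewrite /fClopen sat_and; split; apply: sat_Open => a ha.
  rewrite sat_WinI => -[_ [n [ho hl]]]; exists (sc n).
  split; first by apply: Nat_sc; case: ho.
  move=> b hb h; rewrite sat_WinI; split=> //; exists n; split=> //.
  exact: Lost_congr hl.
rewrite sat_not sat_WinI => hI; have [n hl] := Lost_exists a; exists (sc n).
have hn : Nat n by case: hl.
split; first exact: Nat_sc.
move=> b hb h; rewrite sat_not sat_WinI => -[_ [m [ho hm]]]; apply: hI; split=> //.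
exists n; split=> //; rewrite -(Lost_unique hm (Lost_congr h hl)) //.
Qed.

Lemma proper_class_game rho : sat (@elt M) rho (fProperClassGame univ fWinI).
Proof.
rewrite /fProperClassGame sat_and sat_not sat_ex; split.
  move=> [V /sat_all h]; apply: (@irrefl M V); have /sat_iff := h V.
  by rewrite sat_app1 => -[_]; apply.
apply/sat_all => a; apply/sat_imp; rewrite sat_app1 sat_WinI sat_Play.
by case.
Qed.

End Clopen.

(** * No definable winning strategy for player II *)

Section SecondPlayer.

Variable M : zfModel.
Local Notation "x 'ε' y" := (@elt M x y) (at level 70).
Local Notation "∅" := (@emp M).
Implicit Types (a b c d h i j m n s t u v w x y z A B C D U : M).

Lemma Has_snoc h n y i x : Fn h n ->
  Has (snoc h n y) (sc n) i x <-> Has h n i x \/ exists C, y = mv i C x.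
Proof.
move=> hh; split.
  move=> [m [C [/scP[hm|->]]]]; first by rewrite app_snoc // => e; left; exists m, C.
  by rewrite app_snoc_last // => e; right; exists C.
move=> [[m [C [hm e]]]|[C e]]; [exists m, C|exists n, C].
  by rewrite app_snoc //; split=> //; apply/scP; left.
by rewrite app_snoc_last //; split=> //; apply/scP; right.
Qed.

Lemma Cur_fun h n C D : Cur h n C -> Cur h n D -> C = D.
Proof.
move=> [m [v [x [e hC]]]] [m' [v' [x' [e' hD]]]]; move: hC hD.
have -> : m' = m by apply: sc_inj; rewrite -e -e'.
move=> [->|[-> ->]] [|[]].
- by move=> /mv_inj[].
- by move=> /mv_neq_emp.
- by move=> /esym/mv_neq_emp.
- by move=> _ /mv_inj[].
Qed.

Lemma Cur_snoc h n v C x : Fn h n -> Cur (snoc h n (mv v C x)) (sc n) C.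
Proof. by move=> hh; exists n, v, x; split=> //; left; rewrite app_snoc_last. Qed.

Lemma Normal_snoc h n y : Nat n -> Fn h n -> n <> ∅ ->
  Normal (snoc h n y) n <-> exists C v D x, Cur h n C /\ y = mv v D x /\
    op v D ε C /\ (D = ∅ -> forall i j, v = op i j -> Test h n i j).
Proof.
move=> hn hh n0.
(* After a pass [Cur] reads the first move, which must therefore belong to the part that [snoc]
   leaves unchanged. *)
have i0 : ∅ ε n.
  by have [//|[m [hm ->]]] := nat_case hn; apply: emp_lt_sc.
have eC C : Cur (snoc h n y) n C <-> Cur h n C.
  have aux m : n = sc m -> m ε n by move=> ->; apply/scP; right.
  split=> -[m [v [x [e hC]]]]; exists m, v, x; split=> //; move: hC;
    by rewrite (app_snoc _ hh i0) (app_snoc _ hh (aux m e)).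
have eH i x : Has (snoc h n y) n i x <-> Has h n i x.
  by split; apply: Has_congr => m hm; rewrite app_snoc.
rewrite /Normal; split=> -[C [v [D [x [hC [e [h1 h2]]]]]]]; exists C, v, D, x.
  rewrite -eC; split=> //; split; first by rewrite -e app_snoc_last.
  split=> // eD i j ev; have [u [w [hu [hw hm]]]] := h2 eD i j ev.
  by exists u, w; rewrite -!eH.
rewrite eC app_snoc_last //; split=> //; split=> //; split=> // eD i j ev.
by have [u [w [hu [hw hm]]]] := h2 eD i j ev; exists u, w; rewrite !eH.
Qed.

Section Strategy.

Variable R : M -> M -> Prop.
Hypothesis dfnR : dfn (fun rho => R (rho 0) (rho 1)).
Hypothesis totR : forall s n, Nat n -> Fn s n -> exists y, R s y.
Hypothesis funR : forall s n y y', Nat n -> Fn s n -> R s y -> R s y' -> y = y'.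
Hypothesis winR : forall a, Fn a (omega M) ->
  (forall n, Odd n -> R (restr a n) (app a n)) -> ~ WinI a.

Definition Pos h n := Nat n /\ Fn h n /\ (forall m, m ε n -> Legal h m) /\
  (forall m, m ε n -> Odd m -> R (restr h m) (app h m)).

(* An illegal answer of the strategy would lose the play that goes on from it,
   with both players following the strategy. *)
Lemma Legal_answer h n y : Pos h n -> Odd n -> R h y -> Legal (snoc h n y) n.
Proof.
move=> [hn [hh [hl hf]]] ho hy.
(* [k] is the length of [s]. The play repeats [h] below [n] and obeys [R] from [n] on, at stages of
   either parity. *)
pose Q s z := exists k, Nat k /\ Fn s k /\ ((k ε n /\ z = app h k) \/ (~ k ε n /\ R s z)).
have [|||a [ha hQ]] := recursion (R := Q).
- by rewrite /Q; solve_dfn.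
- move=> s k hk hs; case: (classic (k ε n)) => hkn.
    by exists (app h k), k; auto.
  by have [z hz] := totR hk hs; exists z, k; auto.
- move=> s k z z' hk hs [l [_ [hl1 hz]]] [l' [_ [hl2 hz']]].
  move: hz hz'; rewrite (Fn_dom hl1 hs) (Fn_dom hl2 hs).
  move=> [[h1 ->]|[h1 h2]] [[h3 ->]|[h3 h4]] //.
  exact: funR hk hs h2 h4.
have sub k : Nat k -> forall x, x ε k -> x ε omega M.
  by move=> hk x hx; apply/omegaP; apply: nat_mem hx.
have hQ' k : Nat k -> (k ε n /\ app a k = app h k) \/ (~ k ε n /\ R (restr a k) (app a k)).
  move=> hk; have [l [_ [h1 h2]]] := hQ k hk.
  by have e := Fn_dom (Fn_restr ha (sub k hk)) h1; subst.
have e k : k ε n -> app a k = app h k.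
  by move=> hk; case: (hQ' k (nat_mem hn hk)) => -[].
have er k : (forall x, x ε k -> x ε n) -> restr a k = restr h k.
  move=> hk; apply: (restr_congr ha hh) => x hx; split; first by apply: (sub n hn); apply: hk.
  by split; [apply: hk|apply: e; apply: hk].
have ern : restr a n = h by rewrite er // restr_id.
have en : app a n = y.
  case: (hQ' n hn) => [[/irrefl//]|[_]]; rewrite ern => h1; exact: funR hn hh h1 hy.
have lt k : k ε n -> forall x, x ε k -> x ε n by move=> hk x; apply: nat_trans hn hk.
apply: NNPP => hnl; apply: (winR ha).
  move=> k hk; have hk' : Nat k by case: hk.
  case: (hQ' k hk') => [[hkn ->]|[]//].
  by rewrite er; [apply: hf|apply: lt].
split=> //; exists n; split=> //; split=> //; split.
  move=> h1; apply: hnl; apply: (Legal_congr hn _ h1) => m /scP[hm|->].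
    by rewrite app_snoc // e.
  by rewrite app_snoc_last.
move=> m hm; apply: (Legal_congr (nat_mem hn hm) _ (hl m hm)) => k hk; symmetry; apply: e.
by move: hk => /scP[/(lt m hm)|->].
Qed.

Lemma Pos_snoc h n y : Pos h n -> Legal (snoc h n y) n -> (Odd n -> R h y) ->
  Pos (snoc h n y) (sc n).
Proof.
move=> [hn [hh [hl hf]]] hL hR.
have lt k : k ε n -> forall x, x ε k -> x ε n by move=> hk x; apply: nat_trans hn hk.
split; first exact: Nat_sc.
split; first exact: Fn_snoc.
split=> m /scP[hm|->] //.
- apply: (Legal_congr (nat_mem hn hm) _ (hl m hm)) => k hk; symmetry; apply: app_snoc => //.
  by move: hk => /scP[/(lt m hm)|->].
- by rewrite restr_snoc ?app_snoc //; [apply: hf|apply: lt].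
by rewrite restr_snoc // app_snoc_last // restr_id.
Qed.

(* The children set C is about to be played; U contains the names used so far,
   and the variable k has the name r k and the value rho k. *)
Definition Good h n C U (r rho : nat -> M) := Pos h n /\ Big n /\ Cur h n C /\
  (forall i x, Has h n i x -> i ε U) /\ (forall k x, Has h n (r k) x <-> x = rho k).

(* The player to move wins from C iff P rho holds. *)
Definition Decides C U r (P : (nat -> M) -> Prop) := forall h n rho, Good h n C U r rho ->
  (Odd n -> P rho) /\ (Even n -> ~ P rho).

(** The code may depend on the names in use, since it has to introduce names outside [U]. It is
    nonempty so that moving to it is not subject to the test for leaves. *)
Definition Represented (P : (nat -> M) -> Prop) := forall U r, (forall k, r k ε U) ->
  exists C, C <> ∅ /\ Decides C U r P.

Lemma answer h n C : Pos h n -> Big n -> Cur h n C -> Odd n ->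
  exists v D x, R h (mv v D x) /\ op v D ε C /\
    (D = ∅ -> forall i j, v = op i j -> Test h n i j).
Proof.
move=> hp hB hC ho; have [hn [hh _]] := hp; have [y hy] := totR hn hh.
have := Legal_Big hB (Legal_answer hp ho hy).
case/(Normal_snoc y hn hh (proj1 (proj2 hB))) => C' [v [D [x [hC' [e [h1 h2]]]]]].
exists v, D, x; rewrite -e; split=> //; split=> //.
by rewrite (Cur_fun hC hC').
Qed.

(** All names used so far are elements of [U] and [U] is not an element of itself, so [U] serves as
    a fresh name. The move can then be read in two ways: its value is ignored, or it becomes the
    value of a new variable 0. *)
Lemma Good_snoc h n C U r rho D x : Good h n C U r rho -> (forall k, r k ε U) ->
  op U D ε C -> D <> ∅ -> (Odd n -> R h (mv U D x)) ->
  Good (snoc h n (mv U D x)) (sc n) D (sc U) r rho /\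
  Good (snoc h n (mv U D x)) (sc n) D (sc U) (U .: r) (x .: rho).
Proof.
move=> [hp [hB [hC [hU hr]]]] hrU hD nD hR.
have [hn [hh _]] := hp; have [_ [n0 _]] := hB.
have hL : Legal (snoc h n (mv U D x)) n.
  right; right; apply/(Normal_snoc _ hn hh n0); exists C, U, D, x.
  by split=> //; split=> //; split=> // /nD.
have hp' := Pos_snoc hp hL hR.
have hB' := Big_sc hn n0.
have hC' := Cur_snoc U D x hh.
have hH i z : Has (snoc h n (mv U D x)) (sc n) i z <-> Has h n i z \/ (i = U /\ z = x).
  rewrite Has_snoc //; apply: or_iff_compat_l.
  by split=> [[B /mv_inj[-> _ ->]]|[-> ->]] //; exists D.
have hU' i z : Has (snoc h n (mv U D x)) (sc n) i z -> i ε sc U.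
  by move=> /hH[/hU h1|[-> _]]; apply/scP; [left|right].
have hr' k z : Has (snoc h n (mv U D x)) (sc n) (r k) z <-> z = rho k.
  rewrite hH hr; split=> [[//|[e _]]|]; last by left.
  by have := hrU k; rewrite e => /irrefl.
split; split=> //; split=> //; split=> //; split=> //.
move=> [|k] z; last exact: hr'.
rewrite hH /=; split=> [[/hU/irrefl//|[]//]|->]; by right.
Qed.

(** The mover needs a child that is false for the opponent. At odd stages the strategy names one; at
    even stages player I could try either child, and since the strategy wins both continuations,
    both are true. *)
Lemma Decides_nand A B U r (P Q : (nat -> M) -> Prop) : (forall k, r k ε U) ->
  A <> ∅ -> B <> ∅ -> Decides A (sc U) r P -> Decides B (sc U) r Q ->
  Decides (upair (op U A) (op U B)) U r (fun rho => ~ P rho \/ ~ Q rho).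
Proof.
move=> hrU nA nB hA hB h n rho hg; have [hp [hBig [hC _]]] := hg.
have hn : Nat n by case: hBig.
split=> ht.
  have [v [D [x [hR [hD _]]]]] := answer hp hBig hC ht.
  have he : Even (sc n) by apply/(Even_sc hn); case: ht.
  move: hD => /upairP[] /op_inj[ev eD]; rewrite ev eD in hR.
    have [hg' _] := Good_snoc hg hrU (iffRL (upairP _ _ _) (or_introl erefl)) nA (fun=> hR).
    by left; apply: (proj2 (hA _ _ _ hg')).
  have [hg' _] := Good_snoc hg hrU (iffRL (upairP _ _ _) (or_intror erefl)) nB (fun=> hR).
  by right; apply: (proj2 (hB _ _ _ hg')).
have ho : Odd (sc n) by apply/(Odd_sc hn).
have no y : Odd n -> R h y by case.
(* The value [U] is arbitrary, because the name [U] is not assigned to any variable here. *)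
have [hgA _] := Good_snoc hg hrU (iffRL (upairP _ _ _) (or_introl erefl)) nA (no (mv U A U)).
have [hgB _] := Good_snoc hg hrU (iffRL (upairP _ _ _) (or_intror erefl)) nB (no (mv U B U)).
have := proj1 (hA _ _ _ hgA) ho; have := proj1 (hB _ _ _ hgB) ho; tauto.
Qed.

(** With a single child the only choice left to the mover is the value of [U], which is now kept as
    the value of the new variable: at odd stages the answer of the strategy is the witness. *)
Lemma Decides_ex A U r (P : (nat -> M) -> Prop) : (forall k, r k ε U) ->
  A <> ∅ -> Decides A (sc U) (U .: r) P ->
  Decides (upair (op U A) (op U A)) U r (fun rho => exists x, ~ P (x .: rho)).
Proof.
move=> hrU nA hA h n rho hg; have [hp [hBig [hC _]]] := hg.
have hn : Nat n by case: hBig.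
have hUA : op U A ε upair (op U A) (op U A) by apply/upairP; left.
split=> ht.
  have [v [D [x [hR [hD _]]]]] := answer hp hBig hC ht.
  have he : Even (sc n) by apply/(Even_sc hn); case: ht.
  have {hD} [ev eD] : v = U /\ D = A by apply: op_inj; case/upairP: hD.
  rewrite ev eD in hR; have [_ hg'] := Good_snoc hg hrU hUA nA (fun=> hR).
  by exists x; apply: (proj2 (hA _ _ _ hg')).
have ho : Odd (sc n) by apply/(Odd_sc hn).
move=> [x hx]; apply: hx.
have [|_ hg'] := @Good_snoc _ _ _ _ _ _ _ x hg hrU hUA nA; first by case.
exact: (proj1 (hA _ _ _ hg') ho).
Qed.

Lemma upair_neq_emp x y : upair x y <> ∅.
Proof. by move=> e; apply: (@empP M x); rewrite -e; apply/upairP; left. Qed.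

Lemma Decides_ext C U r (P Q : (nat -> M) -> Prop) : (forall rho, P rho <-> Q rho) ->
  Decides C U r P -> Decides C U r Q.
Proof. by move=> e hC h n rho hg; rewrite -e; apply: hC hg. Qed.

Lemma sc_names U (r : nat -> M) : (forall k, r k ε U) -> forall k, r k ε sc U.
Proof. by move=> h k; apply/scP; left. Qed.

Lemma Represented_ext (P Q : (nat -> M) -> Prop) : (forall rho, P rho <-> Q rho) ->
  Represented P -> Represented Q.
Proof.
move=> e hP U r hr; have [C [nC hC]] := hP U r hr; exists C; split=> //.
exact: Decides_ext hC.
Qed.

Lemma Represented_imp (P Q : (nat -> M) -> Prop) : Represented P -> Represented Q ->
  Represented (fun rho => P rho -> Q rho).
Proof.
move=> hP hQ U r hr; have hr1 := sc_names hr; have hr2 := sc_names hr1.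
have [A [nA hA]] := hP _ _ hr1; have [B [nB hB]] := hQ _ _ hr2.
(* NAND of [P] with the NAND of [Q] with itself; one level deeper the name [U] is spent and [sc U]
   takes its place. *)
exists (upair (op U A) (op U (upair (op (sc U) B) (op (sc U) B)))).
split; first exact: upair_neq_emp.
have hN := Decides_nand hr1 nB nB hB hB.
apply: (Decides_ext _ (Decides_nand hr nA _ hA hN)); last exact: upair_neq_emp.
by move=> rho; tauto.
Qed.

Lemma Represented_all (P : (nat -> M) -> Prop) : Represented P ->
  Represented (fun rho => forall x, P (x .: rho)).
Proof.
move=> hP U r hr; have hr1 := sc_names hr.
have [|A [nA hA]] := hP (sc (sc U)) (sc U .: r).
  by case=> [|k] /=; apply/scP; [right|left; apply: hr1].
(* [B] asserts the existence of a counterexample, and the node above it negates this. That node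
   spends the name [U] on an ignored value, so the quantified variable is named [sc U]. *)
pose B := upair (op (sc U) A) (op (sc U) A).
have hB := Decides_ex hr1 nA hA.
exists (upair (op U B) (op U B)); split; first exact: upair_neq_emp.
have nB : B <> ∅ by apply: upair_neq_emp.
apply: (Decides_ext _ (Decides_nand hr nB nB hB hB)) => rho; split.
  by move=> hn x; apply: NNPP => hx; case: hn; apply; exists x.
by move=> h; left=> -[x]; apply.
Qed.

(** The code has one leaf. Entering it requires passing the test, and whoever enters it leaves the
    opponent without a child to move to. *)
Lemma Represented_mem (k l : nat) : Represented (fun rho => rho k ε rho l).
Proof.
move=> U r hr; pose v := op (r k) (r l).
exists (upair (op v ∅) (op v ∅)); split; first exact: upair_neq_emp.
move=> h n rho [hp [hB [hC [_ hv]]]].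
have [hn [hh _]] := hp; have [_ [n0 _]] := hB.
split=> ht.
  have [w [D [x [_ [hD hT]]]]] := answer hp hB hC ht.
  have [ev eD] : w = v /\ D = ∅ by apply: op_inj; case/upairP: hD.
  by have [y [z [/hv -> [/hv -> //]]]] := hT eD _ _ ev.
move=> hkl.
have hL : Legal (snoc h n (mv v ∅ ∅)) n.
  right; right; apply/(Normal_snoc _ hn hh n0); exists (upair (op v ∅) (op v ∅)), v, ∅, ∅.
  split=> //; split=> //; split; first by apply/upairP; left.
  move=> _ i j /op_inj[<- <-]; exists (rho k), (rho l).
  by split; [apply/hv|split=> //; apply/hv].
have hp' : Pos (snoc h n (mv v ∅ ∅)) (sc n) by apply: Pos_snoc => // -[].
have ho : Odd (sc n) by apply/(Odd_sc hn).
by have [w [D [x [_ [/empP]]]]] := answer hp' (Big_sc hn n0) (Cur_snoc v ∅ ∅ hh) ho.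
Qed.

Lemma Represented_sat (p : form) : Represented (fun rho => sat (@elt M) rho p).
Proof.
(* Falsity is expressed as: every set is an element of itself. *)
have hbot : Represented (fun=> False).
  apply: (Represented_ext _ (Represented_all (Represented_mem 0 0))) => rho.
  by split=> // /(_ ∅)/irrefl.
elim: p => [|x y|x y|p IHp q IHq|p IHp] /=.
- exact: hbot.
- exact: Represented_mem.
(* Equality is expressed through extensionality, with the conjunction written by means of
   implication and falsity. *)
- have h1 := Represented_imp (Represented_mem 0 x.+1) (Represented_mem 0 y.+1).
  have h2 := Represented_imp (Represented_mem 0 y.+1) (Represented_mem 0 x.+1).
  have h3 := Represented_all (Represented_imp (Represented_imp h1 (Represented_imp h2 hbot)) hbot).
  apply: (Represented_ext _ h3) => rho /=; split=> [h|-> z h]; last exact: (h id).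
  by apply: set_ext => z; move: (h z); tauto.
- exact: Represented_imp.
- exact: (Represented_all IHp).
Qed.

End Strategy.

(* The class of all x = (C, q) such that the strategy with parameter q does not
   pass after the first move ((∅, C), x). *)
Definition diagonal (psi : form) : form :=
  (∃ ∃ ∃ ∃ ∃ ∃ ∃ ∃ ∃ fPair 9 8 7 ∧ fEmpty 6 ∧ fPair 5 6 8 ∧ fPair 4 5 9 ∧
    fPair 3 6 4 ∧ fUPair 2 3 3 ∧ fPair 0 2 1 ∧ app2 psi 0 7 ∧ ¬ 1 ≡ 6)%F.

Definition follows (psi : form) (p s y : M) : Prop := sat (@elt M) (env2 (op s y) p) psi.

Lemma snoc_emp y : snoc ∅ ∅ y = upair (op ∅ y) (op ∅ y).
Proof.
apply: set_ext => z; rewrite adjP upairP; split=> [[/empP//|]|[]]; auto.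
Qed.

Lemma sat_diagonal psi p C : let x := op C p in
  sat (@elt M) (fun=> x) (diagonal psi) <->
  exists y, follows psi p (snoc ∅ ∅ (mv ∅ C x)) y /\ y <> ∅.
Proof.
move=> x; rewrite /diagonal /follows sat_ex; split.
  move=> [C' /sat_ex[q /sat_ex[e /sat_ex[c /sat_ex[m /sat_ex[r /sat_ex[s /sat_ex[y]]]]]]]].
  move=> /sat_ex[u]; rewrite 8!sat_and !sat_Pair sat_Empty sat_UPair sat_app2 sat_not /=.
  move=> [/op_inj[e1 e2] [e3 [e4 [e5 [e6 [e7 [e8 [h1 h2]]]]]]]]; subst.
  by exists y; rewrite snoc_emp.
move=> [y [h1 h2]].
exists C; apply/sat_ex; exists p; apply/sat_ex; exists ∅; apply/sat_ex; exists (op ∅ C).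
apply/sat_ex; exists (mv ∅ C x); apply/sat_ex; exists (op ∅ (mv ∅ C x)).
apply/sat_ex; exists (snoc ∅ ∅ (mv ∅ C x)); apply/sat_ex; exists y.
apply/sat_ex; exists (op (snoc ∅ ∅ (mv ∅ C x)) y).
by rewrite 8!sat_and !sat_Pair sat_Empty sat_UPair sat_app2 sat_not /= -snoc_emp.
Qed.

(** Player I opens with a code [C0] and the value [op C0 p], so that [C0] asserts that the strategy
    passes after this very move. If it passes, player I is to move from [C0], which is therefore
    false. If it does not, it has moved to the only child [C], the code of [diagonal psi]; now
    player I is to move from [C], so [C] is false and the strategy passes. *)
Lemma no_strategy_II psi p : let R := follows psi p in
  (forall s n, Nat n -> Fn s n -> exists y, R s y) ->
  (forall s n y y', Nat n -> Fn s n -> R s y -> R s y' -> y = y') ->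
  ~ (forall a, Fn a (omega M) ->
      (forall n, Odd n -> R (restr a n) (app a n)) -> ~ WinI a).
Proof.
move=> R totR funR winR.
have dfnR : dfn (fun rho => R (rho 0) (rho 1)).
  by apply: dfn_env2; solve_dfn.
(* [∅] is the name occurring in the first move. All variables share it, so the formula is evaluated
   with every variable equal to [x0]. *)
pose U := upair ∅ ∅; pose r := fun _ : nat => ∅.
have hr k : r k ε U by apply/upairP; left.
have hr1 := sc_names hr.
have [C [nC hC]] := Represented_sat dfnR totR funR winR (diagonal psi) hr1.
(* [Decides] says nothing about stage 1, where passing is legal. The single child makes a
   non-passing answer lead to [C], to which [Decides] applies at stage 2. *)
pose C0 := upair (op U C) (op U C); pose x0 := op C0 p; pose m0 := mv ∅ C0 x0.
have hC0 := Decides_nand dfnR totR funR winR hr nC nC hC hC.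
set P := fun rho => _ in hC hC0.
have ePx : P (fun=> x0) <-> exists y, R (snoc ∅ ∅ m0) y /\ y <> ∅ by apply: sat_diagonal.
have hF0 := Fn_emp M; have hF1 := Fn_snoc m0 hF0.
set h1 := snoc ∅ ∅ m0 in ePx hF1.
have n0 := @Nat_emp M; have n1 := Nat_sc n0.
have o1 : Odd (sc ∅) by apply/(Odd_sc n0)/Even_emp.
have e2 : Even (sc (sc ∅)) by apply/(Even_sc n1); case: o1.
have hp1 : Pos R h1 (sc ∅).
  split=> //; split=> //; split=> m /scP[/empP//|->]; first by left.
  by case=> _ []; apply: Even_emp.
have [y hy] := totR _ _ n1 hF1.
have hL := Legal_answer dfnR totR funR winR hp1 o1 hy.
have hp2 := Pos_snoc hp1 hL (fun=> hy).
have hB2 : Big (sc (sc ∅)) by apply: Big_sc => //; apply: sc_neq_emp.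
have hH1 i x : Has h1 (sc ∅) i x <-> i = ∅ /\ x = x0.
  rewrite /h1 Has_snoc //; split=> [[[m [? [/empP]]]|[B /mv_inj[]]]|[-> ->]] //.
  by right; exists C0.
have a0 z : app (snoc h1 (sc ∅) z) ∅ = m0.
  by rewrite app_snoc // ?app_snoc_last //; apply/scP; right.
case: hL => [/sc_neq_emp//|[[_ ey]|]].
  rewrite app_snoc_last // in ey; rewrite {}ey in hy hp2.
  have hg : Good R (snoc h1 (sc ∅) ∅) (sc (sc ∅)) C0 U r (fun=> x0).
    split=> //; split=> //; split.
      by exists (sc ∅), ∅, x0; split=> //; right; rewrite app_snoc_last.
    have hH i x : Has (snoc h1 (sc ∅) ∅) (sc (sc ∅)) i x <-> i = ∅ /\ x = x0.
      by rewrite Has_snoc // hH1; split=> [[//|[B /esym/mv_neq_emp]]|]; auto.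
    split=> [i x /hH[-> _]|k x]; first by apply/upairP; left.
    by rewrite hH; split=> [[]|].
  have hn := proj2 (hC0 _ _ _ hg) e2; apply: hn; left=> /ePx[z [hz nz]].
  by apply: nz; apply: (funR _ _ _ _ n1 hF1 hz hy).
case/(Normal_snoc y n1 hF1 (@sc_neq_emp M ∅)) => C1 [v [D [x [hC1 [ey [hD _]]]]]].
have e1 : C1 = C0 by apply: (Cur_fun hC1); apply: Cur_snoc.
rewrite {}e1 in hD; have [ev eD] : v = U /\ D = C by apply: op_inj; case/upairP: hD.
have hP : P (fun=> x0) by apply/ePx; exists y; split=> //; rewrite ey; apply: mv_neq_emp.
apply: (proj2 (hC (snoc h1 (sc ∅) y) (sc (sc ∅)) _ _)) hP => //.
subst v D; subst y; split=> //; split=> //; split; first exact: Cur_snoc.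
have hH i z : Has (snoc h1 (sc ∅) (mv U C x)) (sc (sc ∅)) i z <->
    (i = ∅ /\ z = x0) \/ (i = U /\ z = x).
  rewrite Has_snoc // hH1; apply: or_iff_compat_l.
  by split=> [[B /mv_inj[-> _ ->]]|[-> ->]] //; exists C.
split=> [i z /hH[[-> _]|[-> _]]|k z]; [by apply: (hr1 0)|by apply/scP; right|].
rewrite hH /r; split=> [[[]//|[e _]]|]; last by left.
by case: (@upair_neq_emp ∅ ∅).
Qed.

End SecondPlayer.

(** * No definable winning strategy for player I *)

Section FirstPlayer.

Variable M : zfModel.
Local Notation "x 'ε' y" := (@elt M x y) (at level 70).
Local Notation "∅" := (@emp M).
Implicit Types (a b c d h i j m n s t u v w x y z A B C D U : M).

Variable R : M -> M -> Prop.
Hypothesis dfnR : dfn (fun rho => R (rho 0) (rho 1)).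
Hypothesis totR : forall s n, Nat n -> Fn s n -> exists y, R s y.
Hypothesis funR : forall s n y y', Nat n -> Fn s n -> R s y -> R s y' -> y = y'.

(* The stage n of the play m0, ∅, b_1, b_2, b_3, ... *)
Definition Delayed m0 b n y := (n = ∅ /\ y = m0) \/ (n = sc ∅ /\ y = ∅) \/
  exists m, n = sc m /\ m <> ∅ /\ y = app b m.

Lemma dfn_Delayed (m0 : M) (f g h : (nat -> M) -> M) : dterm f -> dterm g -> dterm h ->
  dfn (fun rho => Delayed m0 (f rho) (g rho) (h rho)).
Proof. by apply: (dfn_app3 (Q := Delayed m0)); rewrite /Delayed; solve_dfn. Qed.

Lemma Delayed_fun m0 b n y y' : Delayed m0 b n y -> Delayed m0 b n y' -> y = y'.
Proof.
move=> [[-> ->]|[[-> ->]|[m [-> [hm ->]]]]].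
- by move=> [[_ ->]|[[/esym/sc_neq_emp]|[m [/esym/sc_neq_emp]]]].
- by move=> [[/sc_neq_emp]|[[_ ->]|[m [/sc_inj <- []]]]].
by move=> [[/sc_neq_emp]|[[/sc_inj]|[k [/sc_inj <- [_ ->]]]]].
Qed.

Lemma delay_exists m0 b d : (forall n, n ε d -> Nat n) ->
  exists f, Fn f d /\ forall n, n ε d -> Delayed m0 b n (app f n).
Proof.
move=> hd; apply: abstraction; first by apply: dfn_Delayed; solve_dfn.
move=> n /hd hn; suff [y hy] : exists y, Delayed m0 b n y.
  by exists y; split=> // y'; apply: Delayed_fun.
have [->|[m [hm ->]]] := nat_case hn; first by exists m0; left.
case: (classic (m = ∅)) => [->|h0]; first by exists ∅; right; left.
by exists (app b m); right; right; exists m.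
Qed.

Lemma Odd_neq_emp n : Odd n -> n <> ∅.
Proof. by move=> [_ h] e; apply: h; rewrite e; apply: Even_emp. Qed.

(* Against a winning strategy of player I with first move m0, player II can
   answer in one play b by the moves of player I in the play a = m0, ∅, b_1,
   b_2, ... in which player II passes, and conversely.  The players have
   exchanged their roles in these two plays, so player I cannot win both. *)
Lemma no_strategy_I : ~ (forall a, Fn a (omega M) ->
  (forall n, Even n -> R (restr a n) (app a n)) -> WinI a).
Proof.
move=> winR.
have n0 := @Nat_emp M; have n1 := Nat_sc n0; have F0 := Fn_emp M.
have [m0 hm0] := totR n0 F0.
(* At an odd stage [k] the move of player II is the answer of [R] to the delayed position [t]. The
   pass makes its length [sc k], which is even, so that player I is to move there. *)
pose Q s y := exists k, Nat k /\ Fn s k /\ ((Even k /\ R s y) \/ (Odd k /\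
  exists t, Fn t (sc k) /\ (forall n, n ε sc k -> Delayed m0 s n (app t n)) /\ R t y)).
have natS k : Nat k -> forall n, n ε sc k -> Nat n.
  by move=> hk n; apply: nat_mem; apply: Nat_sc.
have dt s k t t' : Nat k -> Fn t (sc k) -> (forall n, n ε sc k -> Delayed m0 s n (app t n)) ->
    Fn t' (sc k) -> (forall n, n ε sc k -> Delayed m0 s n (app t' n)) -> t = t'.
  by move=> hk h1 h2 h3 h4; apply: (Fn_ext h1 h3) => n hn; apply: Delayed_fun (h2 _ hn) (h4 _ hn).
have [|||b [hb hQ]] := recursion (R := Q).
- by rewrite /Q /Delayed; solve_dfn.
- move=> s k hk hs; case: (parity hk) => hp.
    by have [y hy] := totR hk hs; exists y, k; auto.
  have [t [ht1 ht2]] := delay_exists m0 s (natS k hk).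
  have [y hy] := totR (Nat_sc hk) ht1; exists y, k; split=> //; split=> //.
  by right; split=> //; exists t.
- move=> s k y y' hk hs [l [_ [hl1 hy]]] [l' [_ [hl2 hy']]].
  move: hy hy'; rewrite (Fn_dom hl1 hs) (Fn_dom hl2 hs).
  move=> [[h1 h2]|[h1 [t [h2 [h3 h4]]]]] [[h1' h2']|[h1' [t' [h2' [h3' h4']]]]].
  + exact: funR hk hs h2 h2'.
  + by case: h1'.
  + by case: h1.
  have e := dt _ _ _ _ hk h2 h3 h2' h3'; subst t'.
  exact: funR (Nat_sc hk) h2 h4 h4'.
have sub k : Nat k -> forall x, x ε k -> x ε omega M.
  by move=> hk x hx; apply/omegaP; apply: nat_mem hx.
have hQ' k : Nat k -> (Even k /\ R (restr b k) (app b k)) \/ (Odd k /\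
    exists t, Fn t (sc k) /\ (forall n, n ε sc k -> Delayed m0 (restr b k) n (app t n)) /\
      R t (app b k)).
  move=> hk; have [l [_ [h1 h2]]] := hQ k hk.
  by have e := Fn_dom (Fn_restr hb (sub k hk)) h1; subst.
have [|a [ha hD]] := @delay_exists m0 b (omega M); first by move=> n /omegaP.
have hD' n : Nat n -> Delayed m0 b n (app a n) by move=> hn; apply: hD; apply/omegaP.
have r0 f : Fn f (omega M) -> restr f ∅ = ∅.
  by move=> hf; apply: Fn_emp_eq; apply: Fn_restr hf _ => x /empP.
have a0 : app a ∅ = m0 by apply: (Delayed_fun (hD' _ n0)); left.
have a1 : app a (sc ∅) = ∅ by apply: (Delayed_fun (hD' _ n1)); right; left.
have aS m : Nat m -> m <> ∅ -> app a (sc m) = app b m.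
  by move=> hm h0; apply: (Delayed_fun (hD' _ (Nat_sc hm))); right; right; exists m.
have b0 : app b ∅ = m0.
  case: (hQ' ∅ n0) => [[_]|[]]; last by move=> /Odd_neq_emp.
  by rewrite r0 // => h; apply: funR n0 F0 h hm0.
have wb : WinI b.
  by apply: winR => // n hn; case: (hQ' n (proj1 hn)) => -[] // [].
(* An even stage of [a] other than 0 is [sc m] with [m] odd, and at [m] the play [b] copied the
   answer of [R] to just this position of [a]. *)
have wa : WinI a.
  apply: winR => // n hn; have hn' := proj1 hn.
  have [e|[m [hm e]]] := nat_case hn'; first by rewrite e r0 // a0.
  rewrite e in hn *; have ho : Odd m by split=> //; apply/(Even_sc hm).
  rewrite aS //; last exact: Odd_neq_emp.
  case: (hQ' m hm) => [[]|[_ [t [h1 [h2 h3]]]]]; first by case: ho.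
  suff -> : restr a (sc m) = t by [].
  have ht := Fn_restr ha (sub _ (Nat_sc hm)).
  apply: (dt (restr b m) m) => // k hk; rewrite app_restr //.
  case: (hD' k (natS m hm k hk)) => [h|[h|[l [el [h4 h5]]]]]; [by left|by right; left|].
  right; right; exists l; split=> //; split=> //; rewrite h5 app_restr //.
  by move: hk; rewrite el => /scP[hk|<-]; [apply: (nat_trans hm hk)|]; apply/scP; right.
(* The plays share the first move, the pass assigns no name, and all other moves are shifted by one
   stage. *)
have eH m i x : Nat m -> m <> ∅ -> (Has a (sc m) i x <-> Has b m i x).
  move=> hm h0; split=> -[k [C [hk e]]].
    have [ek|[l [hl ek]]] := nat_case (natS m hm k hk); rewrite {}ek in hk e.
      by exists ∅, C; split; [have [//|[j [hj ->]]] := nat_case hm; apply: emp_lt_sc|rewrite b0 -a0].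
    case: (classic (l = ∅)) => [el|l0].
      by move: e; rewrite el a1 => /esym/mv_neq_emp.
    exists l, C; rewrite -aS //; split=> //.
    by move: hk => /scP[hk|<-]; [apply: (nat_trans hm hk)|]; apply/scP; right.
  have [ek|[l [hl ek]]] := nat_case (nat_mem hm hk).
    by exists ∅, C; split; [apply: emp_lt_sc|rewrite a0 -b0 -ek].
  exists (sc k), C; split; first exact: sc_le.
  by rewrite aS ?ek // -?ek //; [apply: nat_mem hk|rewrite ek; apply: sc_neq_emp].
have eC m C : Nat m -> m <> ∅ -> (Cur a (sc m) C <-> Cur b m C).
  move=> hm h0; have [//|[l [hl el]]] := nat_case hm; subst m.
  (* For [l = ∅] the pass comes in: stage 2 of [a] and stage 1 of [b] both start from the first
     code. *)
  case: (classic (l = ∅)) => [e0|l0].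
    subst l; split=> -[k [v [x [ek h]]]].
      exists ∅, v, x; split=> //; left; move: h; rewrite -(sc_inj ek) a1 a0 b0.
      by case=> [/esym/mv_neq_emp|[]].
    exists (sc ∅), v, x; split=> //; right; split=> //; move: h.
    by rewrite -(sc_inj ek) b0 a0; case=> [|[]].
  split=> -[k [v [x [ek h]]]].
    by exists l, v, x; split=> //; move: h; rewrite -(sc_inj ek) aS // a0 b0.
  by exists (sc l), v, x; split=> //; move: h; rewrite -(sc_inj ek) aS // a0 b0.
have eN m : Nat m -> m <> ∅ -> (Normal a (sc m) <-> Normal b m).
  move=> hm h0; rewrite /Normal aS //.
  split=> -[C [v [D [x [hC [e [hv hT]]]]]]]; exists C, v, D, x;
    (split; [by apply/eC|split=> //; split=> // eD i j ev]).
    by have [u [w [hu [hw hm']]]] := hT eD i j ev; exists u, w; rewrite -!eH.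
  by have [u [w [hu [hw hm']]]] := hT eD i j ev; exists u, w; rewrite !eH.
(* The first illegal stage of [a] is odd, hence some [sc m] with [m] even. The shift makes [m] the
   first illegal stage of [b], although that stage is odd as well. *)
have [_ [na [oa [hna [la ha']]]]] := wa; have [_ [nb [ob lb]]] := wb.
have [e|[m [hm e]]] := nat_case hna; first by case: (Odd_neq_emp oa).
subst na; have em : Even m by apply/(Odd_sc hm).
(* Otherwise the illegal move of [a] would be the pass at stage 1. *)
have m0' : m <> ∅ by move=> e; apply: la; right; left; rewrite e.
have mB : Big m.
  split=> //; split=> // e; case: (proj2 (iffRL (Odd_sc n0) (Even_emp M))).
  by rewrite -e.
suff lm : Lost b m by case: ob => _ []; rewrite -(Lost_unique lm lb).
split=> //; split=> [h|k hk].
  by apply: la; right; right; apply/(eN m hm m0'); apply: Legal_Big.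
case: (classic (k = ∅)) => [->|k0]; [by left|right; right].
have hk' := nat_mem hm hk; apply/(eN k hk' k0); apply: Legal_Big; first exact: Big_sc.
by apply: ha'; apply: sc_le.
Qed.

End FirstPlayer.

(** * From formulas for strategies to relations on the model *)

Section Strategies.

Variable M : zfModel.
Implicit Types (a n s x y : M) (rho : nat -> M).

Lemma sat_Val rho psi (p s x : nat) :
  sat (@elt M) rho (fVal psi p s x) <-> follows psi (rho p) (rho s) (rho x).
Proof.
rewrite /fVal sat_ex; split=> [[z]|h].
  by rewrite sat_and sat_Pair sat_app2 => -[/= ->].
by exists (op (rho s) (rho x)); rewrite sat_and sat_Pair sat_app2.
Qed.

Lemma sat_Strategy rho psi (p : nat) : sat (@elt M) rho (fStrategy univ psi p) ->
  forall s n, Nat n -> Fn s n -> exists y, forall x, follows psi (rho p) s x <-> x = y.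
Proof.
rewrite /fStrategy sat_and => -[_ /sat_all h] s n hn hs.
have := h s; rewrite sat_imp sat_Position sat_ex => -[|y /sat_all hy]; first by exists n.
by exists y => x; have := hy x; rewrite sat_iff sat_Val.
Qed.

Lemma sat_Winning rho psi W (turn : nat -> form) (T : M -> Prop) (p : nat) :
  (forall rho' k, sat (@elt M) rho' (turn k) <-> T (rho' k)) ->
  sat (@elt M) rho (fWinning univ W psi turn p) ->
  forall a, Fn a (omega M) ->
    (forall n, T n -> follows psi (rho p) (restr a n) (app a n)) -> sat (@elt M) (fun=> a) W.
Proof.
move=> hT; rewrite /fWinning sat_and => -[_ /sat_all h] a ha hf.
have := h a; rewrite sat_imp sat_and sat_Play sat_app1; apply; split=> //.
rewrite /fFollows sat_all => n; rewrite sat_all => s; rewrite sat_all => x.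
rewrite sat_imp !sat_and hT sat_Restr sat_PairIn sat_Val /= => -[hn [-> hx]].
by have [_ ->] := iffLR (in_Fn _ _ ha) hx; apply: hf.
Qed.

Lemma no_winning_strategy rho psi : sat (@elt M) rho (fNoWinningStrategy univ fWinI psi).
Proof.
rewrite /fNoWinningStrategy sat_all => p; rewrite sat_and.
have hs W turn : sat (@elt M) (p .: rho) (fWinning univ W psi turn 0) ->
    (forall s n, Nat n -> Fn s n -> exists y, follows psi p s y) /\
    (forall s n y y', Nat n -> Fn s n -> follows psi p s y -> follows psi p s y' -> y = y').
  rewrite /fWinning sat_and => -[/sat_Strategy h _]; split=> s n => [|y y'] hn hs.
    by have [y hy] := h s n hn hs; exists y; apply/hy.
  by have [z hz] := h s n hn hs => /hz -> /hz ->.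
split; apply/sat_not => h; have [tot fn] := hs _ _ h.
  apply: (no_strategy_I _ tot fn); first by apply: dfn_env2; solve_dfn.
  by move=> a ha hf; have := sat_Winning (@sat_Even M) h ha hf; rewrite sat_WinI.
apply: (no_strategy_II tot fn) => a ha hf.
by have := sat_Winning (@sat_Odd M) h ha hf; rewrite sat_not sat_WinI.
Qed.

End Strategies.

Theorem theorem1 :
  exists X A : form,
    [/\ bounded 1 X /\ bounded 1 A,
        provable ZFC (fProperClassGame X A),
        provable ZFC (fClopen X A)
      & forall psi : form, bounded 2 psi ->
          provable ZFC (fNoWinningStrategy X A psi)].
Proof.
have by_models p : (forall (M : zfModel) rho, sat (@elt M) rho p) -> provable ZFC p.
  move=> h; apply: completeness ZFC_closed _ => M E hM hE rho.
  exact: (h (ZfModel hM hE)).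
exists univ, fWinI; split=> [//|||psi _]; apply: by_models => M rho.
- exact: proper_class_game.
- exact: clopen.
- exact: no_winning_strategy.
Qed.
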